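(* Let $\Omega\subseteq\mathbb{C}$ be an open disc centered at the origin, $M:\Omega\to\mathbb{C}^{n\times n}$ analytic with $M(0)$ invertible, written as $M(\lambda)=\sum_{i=1}^m M_if_i(\lambda)$ with $f_i$ scalar analytic on $\Omega$, and let $\mathcal{B}$ be the operator defined in the context. Let $N\ge 0$ be an integer, $Y\in\mathbb{C}^{n\times p}$, $S\in\mathbb{C}^{p\times p}$ invertible with $\sigma(S)\subset\Omega$, $c\in\mathbb{C}^p$ and $x_0,\ldots,x_{N-1}\in\mathbb{C}^n$. Suppose $$\varphi(\theta)=Y\exp_{N-1}(\theta S)c+\sum_{j=0}^{N-1}\theta^j x_j.$$ Then $$(\mathcal{B}\varphi)(\theta)=Y\exp_N(\theta S)c_+ +\sum_{j=0}^{N}\theta^j x_{+,j},$$ where $c_+=S^{-1}c$, $x_{+,j}=\frac{1}{j}x_{j-1}$ for $j=1,\ldots,N$, and $$x_{+,0}=-M(0)^{-1}\Big(\mathbb{M}_N(Y,S)c_+ +\sum_{i=1}^N M^{(i)}(0)x_{+,i}\Big).$$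
   Context: $B(\lambda)=M(0)^{-1}\frac{M(0)-M(\lambda)}{\lambda}$ for $\lambda\ne0$, extended analytically to $0$. $\mathcal{B}$ acts on smooth $\varphi:\mathbb{R}\to\mathbb{C}^n$ (for which the series below converges) by $(\mathcal{B}\varphi)(\theta)=\int_0^\theta\varphi(\hat\theta)d\hat\theta+\sum_{i=0}^\infty\frac{1}{i!}B^{(i)}(0)\varphi^{(i)}(0)$. For an integer $N\ge -1$, $\exp_N(\theta S):=\sum_{k=N+1}^\infty\frac{\theta^kS^k}{k!}$ (so $\exp_{-1}(\theta S)=\exp(\theta S)$), i.e. the remainder of the Taylor expansion of the exponential after order $N$. $\mathbb{M}(Y,S):=\sum_{i=1}^m M_iYf_i(S)$ and $\mathbb{M}_N(Y,S):=\sum_{k=N+1}^\infty\frac{1}{k!}M^{(k)}(0)YS^k=\mathbb{M}(Y,S)-\sum_{k=0}^N\frac{1}{k!}M^{(k)}(0)YS^k$. When $N=0$ the polynomial part of $\varphi$ is empty and the sum in $x_{+,0}$ is empty. *)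

(* Defs.v *)
From HB Require Import structures.
From mathcomp Require Import all_boot all_order all_algebra.
From mathcomp Require Import all_classical all_reals all_analysis.
From mathcomp Require Export complex.
Export Order.TTheory GRing.Theory Num.Theory.
Export numFieldNormedType.Exports.

Set Implicit Arguments.
Unset Strict Implicit.
Unset Printing Implicit Defensive.

Local Open Scope classical_set_scope.
Local Open Scope ring_scope.
Local Open Scope complex_scope.

Section Defs.
Variable R : realType.
Local Notation C := R[i].

Definition has_sum (K : numFieldType) (V : normedModType K)
  (u : nat -> V) (s : V) : Prop :=
  (fun n => \sum_(k < n) u k) @ \oo --> s.

Definition in_disc (r : R) (z : C) : Prop := `|z| < r%:C.

Definition analytic_on_disc (r : R) (f : C -> C) : Prop :=
  forall z0, in_disc r z0 ->
    exists (a : nat -> C) (d : R), 0 < d /\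
      forall z, `|z - z0| < d%:C ->
        @has_sum C C^o (fun k => a k * (z - z0) ^+ k) (f z).

Definition cderivn (V : normedModType C) (k : nat) (g : C^o -> V) (z : C) : V :=
  derive1n k g z.

Definition series_sum (K : numFieldType) (V : normedModType K) (u : nat -> V) : V :=
  lim ((fun n => \sum_(k < n) u k) @ \oo).

(* exp_K (A) := sum_{k >= K+1} A^k / k!   (remainder of exp after order K);
   here indexed by the first retained order L = K+1, so
   exp_tail L A = exp_{L-1}(A). *)
Definition exp_tail (p : nat) (L : nat) (A : 'M[C]_p) : 'M[C]_p :=
  series_sum (fun k : nat => if (L <= k)%N then (k`!%:R)^-1 *: A ^+ k else 0).

(* Matrix function f(S) for f analytic on a disc centred at 0 containing
   the spectrum of S: the Taylor series of f at 0 evaluated at S. *)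
Definition matfun (p : nat) (f : C -> C) (S : 'M[C]_p) : 'M[C]_p :=
  series_sum (fun k : nat => ((k`!%:R)^-1 * cderivn k (f : C^o -> C^o) 0) *: S ^+ k).

Definition Mfun (n m : nat) (Ms : 'I_m -> 'M[C]_n) (f : 'I_m -> C -> C)
  (l : C) : 'M[C]_n := \sum_(i < m) f i l *: Ms i.

(* B(lambda) = M(0)^{-1} (M(0) - M(lambda)) / lambda, extended at 0 by its
   limit value -M(0)^{-1} M'(0) (the analytic extension). *)
Definition Bfun (n m : nat) (Ms : 'I_m -> 'M[C]_n) (f : 'I_m -> C -> C)
  (l : C) : 'M[C]_n :=
  let M := Mfun Ms f in
  if l == 0 then - (invmx (M 0) *m cderivn 1 (M : C^o -> 'M[C]_n) 0)
  else l^-1 *: (invmx (M 0) *m (M 0 - M l)).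

Definition bbM (n m p : nat) (Ms : 'I_m -> 'M[C]_n) (f : 'I_m -> C -> C)
  (Y : 'M[C]_(n, p)) (S : 'M[C]_p) : 'M[C]_(n, p) :=
  \sum_(i < m) Ms i *m Y *m matfun (f i) S.

Definition bbM_N (n m p : nat) (Ms : 'I_m -> 'M[C]_n) (f : 'I_m -> C -> C)
  (N : nat) (Y : 'M[C]_(n, p)) (S : 'M[C]_p) : 'M[C]_(n, p) :=
  bbM Ms f Y S -
  \sum_(k < N.+1) (k`!%:R)^-1 *:
     (cderivn k (Mfun Ms f : C^o -> 'M[C]_n) 0 *m Y *m S ^+ k).

Definition rderivn (n : nat) (k : nat) (g : R -> 'cV[C]_n) (t : R) : 'cV[C]_n :=
  map_mx (real_complex R) (derive1n k (fun s => map_mx (@complex.Re R) (g s)) t) +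
  'i *: map_mx (real_complex R) (derive1n k (fun s => map_mx (@complex.Im R) (g s)) t).

Definition ointR (a b : R) (h : R -> R) : R :=
  if a <= b then \int[lebesgue_measure]_(x in `[a, b]) h x
  else - \int[lebesgue_measure]_(x in `[b, a]) h x.

Definition vint (n : nat) (g : R -> 'cV[C]_n) (theta : R) : 'cV[C]_n :=
  \col_j ((ointR 0 theta (fun t => complex.Re (g t j ord0)))%:C +
          'i * (ointR 0 theta (fun t => complex.Im (g t j ord0)))%:C).

(* The operator bbB: (Bphi)(theta) = int_0^theta phi + s, where s is the sum
   of the series  sum_i (1/i!) B^{(i)}(0) phi^{(i)}(0).  The statement
   "(Bphi)(theta) = v" is rendered as: this series converges, to some s, and
   int_0^theta phi + s = v. *)
Definition B_series_term (n m : nat) (Ms : 'I_m -> 'M[C]_n)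
  (f : 'I_m -> C -> C) (phi : R -> 'cV[C]_n) (i : nat) : 'cV[C]_n :=
  (i`!%:R)^-1 *: (cderivn i (Bfun Ms f : C^o -> 'M[C]_n) 0 *m rderivn i phi 0).

End Defs.

(* Main.v *)
Require Import Defs.
From HB Require Import structures.
From mathcomp Require Import all_boot all_order all_algebra.
From mathcomp Require Import all_classical all_reals all_analysis.
From mathcomp Require Import complex ring lra.
Import Order.TTheory GRing.Theory Num.Theory.
Import numFieldNormedType.Exports.
Local Open Scope classical_set_scope.
Local Open Scope ring_scope.
Local Open Scope complex_scope.

Set Implicit Arguments.
Unset Strict Implicit.
Unset Printing Implicit Defensive.

(** Both [phi] and the claimed image [Psi] are entire power series in [theta]
    with [Psi' = phi], so [Psi theta - Psi 0] is the integral part of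
    [B phi], and it remains to identify [Psi 0] with the sum of
    [B^(i)(0) phi^(i)(0) / i!].  Writing [M = sum A_k lambda^k], the i-th term
    is [- M(0)^-1 A_(i+1) phi^(i)(0)]; the terms [i < N] give the sum over
    [M^(i)(0) x_(+,i)] and the others, since [S^i c = S^(i+1) c_+], give the
    tail of [sum A_k Y S^k c_+].

    Convergence of that tail needs the Taylor series of each [f_i] at 0 to
    converge on the whole disc.  This is obtained without integration: a
    Cauchy estimate comes from averaging over roots of unity, and, if the
    radius [r0] of the Taylor series were smaller than [r], a uniform radius
    [e] of analyticity near the closed disc of radius [r0] would give
    [|a_n| (rho + e)^n <= (n + 1) B] for every [rho < r0]. *)

Lemma big_ord_cut (V : nmodType) (F : nat -> V) (n N : nat) : (n <= N)%N ->
  \sum_(i < N) F i = \sum_(i < n) F i + \sum_(i < N - n) F (n + i)%N.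
Proof. by move=> nN; rewrite -[in LHS](subnKC nN) big_split_ord. Qed.

(** * Sums of series *)

Section HasSum.
Variables (K : numFieldType) (V : normedModType K).
Implicit Types (u v : nat -> V) (s t : V).

Lemma eq_cvg_to (T : Type) (F : set_system T) (u v : T -> V) s :
  u =1 v -> u @ F --> s -> v @ F --> s.
Proof. by move=> /funext ->. Qed.

Lemma has_sum_unique u s t : has_sum u s -> has_sum u t -> s = t.
Proof. by move=> us ut; apply: (cvg_unique _ us ut). Qed.

Lemma series_sumE u s : has_sum u s -> series_sum u = s.
Proof. by move=> us; apply: (cvg_lim _ us). Qed.

Lemma eq_has_sum u v s : u =1 v -> has_sum u s -> has_sum v s.
Proof. by move=> /funext ->. Qed.

Lemma has_sumD u v s t :
  has_sum u s -> has_sum v t -> has_sum (fun k => u k + v k) (s + t).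
Proof.
move=> us vt; rewrite /has_sum; under eq_fun do rewrite big_split /=.
exact: cvgD.
Qed.

Lemma has_sumN u s : has_sum u s -> has_sum (fun k => - u k) (- s).
Proof.
move=> us; rewrite /has_sum; under eq_fun do rewrite sumrN /=.
exact: cvgN.
Qed.

Lemma has_sumB u v s t :
  has_sum u s -> has_sum v t -> has_sum (fun k => u k - v k) (s - t).
Proof. by move=> us vt; exact: has_sumD us (has_sumN vt). Qed.

Lemma has_sumZ (a : K) u s : has_sum u s -> has_sum (fun k => a *: u k) (a *: s).
Proof.
move=> us; rewrite /has_sum; under eq_fun do rewrite -scaler_sumr.
exact: cvgZl_tmp.
Qed.

Lemma has_sum0 : has_sum (fun=> 0 : V) 0.
Proof.
rewrite /has_sum; under eq_fun do rewrite big1//.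
exact: cvg_cst.
Qed.

Lemma has_sum_big (I : Type) (r : seq I) (u : I -> nat -> V) (s : I -> V) :
  (forall i, has_sum (u i) (s i)) ->
  has_sum (fun k => \sum_(i <- r) u i k) (\sum_(i <- r) s i).
Proof.
move=> H; elim: r => [|i r IH].
  by rewrite big_nil; refine (eq_has_sum _ (has_sum0)) => k; rewrite big_nil.
rewrite big_cons; refine (eq_has_sum _ (has_sumD (H i) IH)) => k.
by rewrite big_cons.
Qed.

Lemma has_sum_drop (n : nat) u s :
  has_sum u s <-> has_sum (fun k => u (n + k)%N) (s - \sum_(k < n) u k).
Proof.
have E N : \sum_(k < N) u (n + k)%N = \sum_(k < N + n) u k - \sum_(k < n) u k.
  rewrite addnC [in X in _ = X - _]big_split_ord /=.
  by rewrite addrAC subrr add0r.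
rewrite /has_sum; split => [us|H].
  under eq_fun do rewrite E.
  have us1 : \sum_(k < N + n) u k @[N --> \oo] --> s.
    by have := us; rewrite -(@cvg_shiftn n _ (fun m => \sum_(k < m) u k)).
  by apply: cvgB; [exact: us1|exact: cvg_cst].
have cc : (fun _ : nat => \sum_(k < n) u k) @ \oo --> \sum_(k < n) u k.
  exact: cvg_cst.
rewrite -[s](subrK (\sum_(k < n) u k)) -(@cvg_shiftn n _ (fun m => \sum_(k < m) u k)).
refine (eq_cvg_to _ (cvgD H cc)) => N.
by rewrite /= fctE E subrK.
Qed.

Lemma has_sum_fin (n : nat) u :
  (forall k, (n <= k)%N -> u k = 0) -> has_sum u (\sum_(k < n) u k).
Proof.
move=> u0; apply/(has_sum_drop n); rewrite subrr.
by apply: eq_has_sum has_sum0 => k; rewrite u0// leq_addr.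
Qed.

Lemma has_sum_le u s (B : K) : has_sum u s ->
  (forall n, `|\sum_(k < n) u k| <= B) -> `|s| <= B.
Proof.
move=> /cvgrPdist_lt us uB.
have B0 : 0 <= B by apply: le_trans (uB 0%N).
(* The order of [K] is only partial; both sides are nonnegative, hence comparable. *)
rewrite real_leNgt ?ger0_real//; apply/negP => Bs.
have e0 : 0 < `|s| - B by rewrite subr_gt0.
have [n _ /(_ n (leqnn n))/= H] := us _ e0.
have := ler_normD (s - \sum_(k < n) u k) (\sum_(k < n) u k).
rewrite subrK => /le_lt_trans => /(_ (`|s| - B + B)).
by rewrite ltr_leD// => /(_ isT); rewrite subrK ltxx.
Qed.

Lemma has_sum_terms_cvg0 u s : has_sum u s -> u @ \oo --> 0.
Proof.
move=> us; rewrite -(subrr s).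
have us1 : \sum_(k < n.+1) u k @[n --> \oo] --> s.
  by move: us; rewrite /has_sum -(@cvg_shiftS _ (fun n => \sum_(k < n) u k)).
refine (eq_cvg_to _ (cvgB us1 us)) => n.
by rewrite fctE big_ord_recr/= addrAC subrr add0r.
Qed.

Lemma has_sum_bounded u s : has_sum u s -> exists2 C : K, 0 <= C & forall k, `|u k| <= C.
Proof.
move=> /has_sum_terms_cvg0 u0.
have /cvg_seq_bounded[M [Mr HM]] : cvgn u by apply/cvg_ex; exists 0.
exists (`|M| + 1) => [|k]; first by rewrite addr_ge0.
apply: (HM (`|M| + 1)) => //.
by rewrite (le_lt_trans (real_ler_norm Mr))// ltrDl.
Qed.

End HasSum.

(* The form of completeness used below; it is shared by [R] and [R[i]], the
   latter having no complete-space instance in the library. *)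
Definition geo_complete (K : numFieldType) :=
  forall (u : nat -> K^o) (C q : K), 0 <= q -> q < 1 ->
    (forall k, `|u k| <= C * q ^+ k) -> exists s : K^o, has_sum u s.

Lemma geo_partial_le (K : numFieldType) (C q : K) n : 0 <= C -> 0 <= q -> q < 1 ->
  \sum_(k < n) C * q ^+ k <= C / (1 - q).
Proof.
move=> C0 q0 q1; have q1' : 0 < 1 - q by rewrite subr_gt0.
rewrite -mulr_sumr ler_wpM2l// -[leRHS]mul1r ler_pdivlMr// mulrC -[1 - q]opprB mulNr -subrX1 opprB.
by rewrite gerBl exprn_ge0.
Qed.

Section Geo.
Variables (K : numFieldType) (V : normedModType K).
Implicit Types (u : nat -> V) (s : V) (C q : K).

Lemma geo_has_sum_le u s C q : 0 <= q -> q < 1 ->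
  (forall k, `|u k| <= C * q ^+ k) -> has_sum u s -> `|s| <= C / (1 - q).
Proof.
move=> q0 q1 uC us.
have C0 : 0 <= C by have := le_trans _ (uC 0%N); rewrite expr0 mulr1; exact.
apply: has_sum_le us _ => n; apply: (le_trans (ler_norm_sum _ _ _)).
apply: (@le_trans _ _ (\sum_(k < n) C * q ^+ k)); first exact: ler_sum.
exact: geo_partial_le.
Qed.

Lemma geo_tail_le n u s C q : 0 <= q -> q < 1 ->
  (forall k, (n <= k)%N -> `|u k| <= C * q ^+ k) -> has_sum u s ->
  `|s - \sum_(k < n) u k| <= C * q ^+ n / (1 - q).
Proof.
move=> q0 q1 uC us; apply: geo_has_sum_le ((has_sum_drop n u s).1 us) => // k.
by rewrite -mulrA -exprD uC// leq_addr.
Qed.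

End Geo.

(** * Power series *)

Section Complete.
Variable K : numFieldType.
Hypothesis Kc : geo_complete K.

(** [K] is not assumed archimedean: [C q^n] tends to 0 as the general term of a series that
    [geo_complete] makes convergent. *)
Lemma geo_cvg0 (C q : K) (e : K) : 0 <= C -> 0 <= q -> q < 1 -> 0 < e ->
  exists n0, forall n, (n0 <= n)%N -> C * q ^+ n < e.
Proof.
move=> C0 q0 q1 e0.
have [k|s us] := @Kc (fun k => C * q ^+ k) C q q0 q1.
  by rewrite ger0_norm// mulr_ge0// exprn_ge0.
have /cvgrPdist_lt/(_ _ e0)[n0 _ H] := has_sum_terms_cvg0 us.
exists n0 => n /H /=; rewrite sub0r normrN ger0_norm//.
by rewrite mulr_ge0// exprn_ge0.
Qed.

Lemma has_sum_geo_tail (V : normedModType K) (u : nat -> V) (s : V) (C q : K) :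
  0 <= C -> 0 <= q -> q < 1 -> (forall n, `|s - \sum_(k < n) u k| <= C * q ^+ n) ->
  has_sum u s.
Proof.
move=> C0 q0 q1 H; apply/cvgrPdist_lt => e e0.
have [n0 Hn] := geo_cvg0 C0 q0 q1 e0.
by exists n0 => // n /= n0n; apply: le_lt_trans (H n) (Hn n n0n).
Qed.

Lemma lt_between (x y : K) : x < y -> exists2 z, x < z & z < y.
Proof. by move=> xy; exists ((x + y) / 2); rewrite midf_lt. Qed.

Definition psum (a : nat -> K) (d : K) (f : K -> K) : Prop :=
  forall z : K, `|z| < d -> @has_sum K K^o (fun k => a k * z ^+ k) (f z).

Lemma psum_bounded a d f (r : K) : psum a d f -> 0 <= r -> r < d ->
  exists2 C : K, 0 <= C & forall k, `|a k| * r ^+ k <= C.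
Proof.
move=> af r0 rd; have rz : `|r| < d by rewrite ger0_norm.
have [C C0 H] := has_sum_bounded (af r rz).
by exists C => // k; rewrite (le_trans _ (H k))// normrM normrX (ger0_norm r0).
Qed.

(** Abel's lemma: boundedness at a radius [r > |z|] makes the terms at [z] geometric with ratio
    [|z| / r]. *)
Lemma psum_of_bounded a (d : K) :
  (forall r : K, 0 <= r -> r < d -> exists C : K, forall k, `|a k| * r ^+ k <= C) ->
  forall z : K, `|z| < d -> exists s : K^o, has_sum (fun k => a k * z ^+ k) s.
Proof.
move=> H z zd; have [r zr rd] := lt_between zd.
have r0 : 0 < r by apply: le_lt_trans zr.
have [C HC] := H r (ltW r0) rd.
apply: (@Kc _ C (`|z| / r)); rewrite ?divr_ge0 ?(ltW r0) ?ltr_pdivrMr ?mul1r// => k.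
rewrite normrM normrX expr_div_n mulrA ler_pdivlMr ?exprn_gt0//.
by rewrite mulrAC ler_wpM2r ?exprn_ge0// HC.
Qed.

Lemma binom_term_le (r h : K) (n k : nat) : 0 <= r -> 0 <= h ->
  (r ^+ (n - k) * h ^+ k) *+ 'C(n, k) <= (r + h) ^+ n.
Proof.
move=> r0 h0; have [kn|nk] := leqP k n; last first.
  by rewrite bin_small// mulr0n exprn_ge0// addr_ge0.
rewrite exprDn (bigD1 (Ordinal (kn : (k < n.+1)%N)))//= lerDl.
by apply: sumr_ge0 => i _; rewrite mulrn_wge0// mulr_ge0// exprn_ge0.
Qed.

(* [recoef a z0 k] is the series whose sum is the k-th coefficient of the
   power series [a] recentered at [z0]. *)
Definition recoef (a : nat -> K) (z0 : K) (k j : nat) : K :=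
  (a (k + j)%N * z0 ^+ j) *+ 'C(k + j, k).

(* Instead of exchanging a double sum, the truncation of the recentered series
   at order [n] is compared termwise with the original series: the terms of
   order below [n] cancel and the others are bounded by [C q^k]. *)
Lemma psum_reexpand a d f (z0 : K) : psum a d f -> `|z0| < d ->
  exists2 b, psum b (d - `|z0|) (fun h => f (z0 + h)) &
    forall k, @has_sum K K^o (recoef a z0 k) (b k).
Proof.
move=> af z0d.
have ex k : exists b : K^o, has_sum (recoef a z0 k) b.
  have [r zr rd] := lt_between z0d.
  have [s zs sr] := lt_between zr.
  have r0 : 0 < r by apply: le_lt_trans zr.
  have s0 : 0 < s by apply: le_lt_trans zs.
  have [C C0 HC] := psum_bounded af (ltW r0) rd.
  (* Since [|z0| + h = s], [binom_term_le] bounds the j-th term by [C / h^k] times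
     [(s / r)^(k + j)]. *)
  pose h := s - `|z0|; have h0 : 0 < h by rewrite subr_gt0.
  apply: (@Kc _ (C / h ^+ k * (s / r) ^+ k) (s / r)).
  - by rewrite divr_ge0 ?ltW.
  - by rewrite ltr_pdivrMr ?mul1r.
  move=> j; rewrite /recoef normrMn normrM normrX -mulrA -exprD.
  rewrite mulrAC ler_pdivlMr ?exprn_gt0// expr_div_n mulrA ler_pdivlMr ?exprn_gt0//.
  have := binom_term_le (k + j) k (normr_ge0 z0) (ltW h0).
  rewrite addKn addrC subrK => B.
  rewrite -mulrA [_ ^+ k * _]mulrC mulrA.
  rewrite mulrnAl -mulrA -mulrnAr -mulrnAl mulrAC.
  rewrite [X in _ * X <= _]mulrC mulrACA mulrnAr [h ^+ k * _]mulrC.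
  by apply: ler_pM => //; rewrite ?mulr_ge0 ?mulrn_wge0 ?mulr_ge0 ?exprn_ge0// ltW.
have [b Hb] := choice ex.
exists b => // h hd.
have d1 : `|z0| + `|h| < d by rewrite addrC -ltrBrDr.
have [r zr rd] := lt_between d1.
have r0 : 0 < r by apply: le_lt_trans zr; rewrite addr_ge0.
have [C C0 HC] := psum_bounded af (ltW r0) rd.
set q := (`|z0| + `|h|) / r.
have q0 : 0 <= q by rewrite divr_ge0 ?addr_ge0// ltW.
have q1 : q < 1 by rewrite ltr_pdivrMr ?mul1r.
(* [T k n] is the part of degree [k] in [h] of [a n (z0 + h)^n]: over [n] it sums to [b k h^k], over
   [k] to the original term. *)
pose T k n := (a n * (z0 ^+ (n - k) * h ^+ k)) *+ 'C(n, k).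
have HT k : @has_sum K K^o (T k) (b k * h ^+ k).
  apply/(has_sum_drop k); rewrite big1 ?subr0; last first.
    by move=> i _; rewrite /T bin_small.
  rewrite mulrC; refine (eq_has_sum _ (has_sumZ (a := h ^+ k) (Hb k))) => j.
  have -> : T k (k + j)%N = recoef a z0 k j * h ^+ k.
    by rewrite /T /recoef addKn mulrnAl mulrA.
  exact: mulrC.
have HF : @has_sum K K^o (fun n => a n * (z0 + h) ^+ n) (f (z0 + h)).
  by apply: af; apply: le_lt_trans (ler_normD _ _) d1.
apply: (@has_sum_geo_tail _ _ _ (C / (1 - q)) q) => //.
  by rewrite divr_ge0// subr_ge0 ltW.
move=> n.
have HS := has_sumB HF (has_sum_big (r := index_enum 'I_n) (fun i => HT i)).
have E k : a k * (z0 + h) ^+ k = \sum_(i < k.+1) T i k.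
  by rewrite exprDn mulr_sumr; apply: eq_bigr => i _; rewrite mulrnAr.
rewrite mulrAC; have := geo_tail_le (n := n) q0 q1 _ HS.
rewrite [X in _ - X]big1 ?subr0; last first.
  move=> [i ni] _ /=; rewrite E (big_ord_cut (T^~ i) ni) opprD addrA subrr add0r.
  rewrite big1 ?oppr0// => j _.
  by rewrite /T bin_small// addSn ltnS leq_addr.
apply => k nk.
have -> : a k * (z0 + h) ^+ k - \sum_(i < n) T i k = \sum_(i < k.+1 - n) T (n + i)%N k.
  have nk1 : (n <= k.+1)%N by rewrite (leq_trans nk).
  by rewrite E (big_ord_cut (T^~ k) nk1) addrAC subrr add0r.
apply: (le_trans (ler_norm_sum _ _ _)).
have Tn i : `|T i k| = `|a k| * ((`|z0| ^+ (k - i) * `|h| ^+ i) *+ 'C(k, i)).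
  by rewrite normrMn !normrM !normrX mulrnAr.
apply: (@le_trans _ _ (\sum_(i < k.+1) `|T i k|)).
  have nk1 : (n <= k.+1)%N by rewrite (leq_trans nk).
  by rewrite (big_ord_cut (fun i => `|T i k|) nk1) lerDr sumr_ge0.
rewrite (eq_bigr _ (fun (i : 'I_k.+1) _ => Tn i)) -mulr_sumr -exprDn.
by rewrite expr_div_n mulrA ler_pdivlMr ?exprn_gt0// mulrAC ler_wpM2r.
Qed.

Lemma psum_at0 a d f : psum a d f -> 0 < d -> f 0 = a 0%N.
Proof.
move=> af d0; have := af 0; rewrite normr0 => /(_ d0) H.
rewrite (has_sum_unique H (has_sum_fin (n := 1) _)) ?big_ord1 ?expr0 ?mulr1//.
by case=> // k _; rewrite expr0n mulr0.
Qed.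

(** The remainder after [b 0 + b 1 h] is at most [D |h|^2], so the quotient is within [D |h|] of
    [b 1]. *)
Lemma psum_derive_at0 b e g : psum b e g -> 0 < e ->
  h^-1 *: (g h - g 0 : K^o) @[h --> 0^'] --> (b 1%N : K^o).
Proof.
move=> bg e0; have [r r0 re] := lt_between e0.
have [C C0 HC] := psum_bounded bg (ltW r0) re.
apply/cvgrPdist_lt => eps eps0.
(* The factor 2 bounds [(1 - q)^-1], since [q = |h| / r] is kept below 1/2. *)
pose D := C * 2 / r ^+ 2.
have D0 : 0 <= D by apply: divr_ge0; [exact: mulr_ge0|exact/exprn_ge0/ltW].
have D1 : 0 < D + 1 by rewrite ltr_wpDl.
near=> h.
have h0 : h != 0 by near: h; exact: nbhs_dnbhs_neq.
have hn0 : 0 < `|h| by rewrite normr_gt0.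
have hr : `|h| < r / 2 by near: h; apply: dnbhs0_lt; rewrite divr_gt0.
have heps : `|h| < eps / (D + 1) by near: h; apply: dnbhs0_lt; rewrite divr_gt0.
set q := `|h| / r.
have q0 : 0 <= q by rewrite divr_ge0 ?ltW.
have qh : q < 2^-1 by rewrite ltr_pdivrMr// mulrC.
have q1 : q < 1 by apply: lt_trans qh _; rewrite invf_lt1 ?ltr1n.
have qq : (1 - q)^-1 <= 2.
  have half : 1 - 2^-1 = 2^-1 :> K by rewrite {1}(splitr 1) mul1r addrK.
  rewrite -[leRHS]invrK lef_pV2 ?posrE ?subr_gt0 ?invr_gt0 ?ltr0n//.
  by rewrite -half lerB// ltW.
have he : `|h| < e.
  by apply: lt_trans hr (lt_trans _ re); rewrite ltr_pdivrMr// ltr_pMr// ltr1n.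
have T : `|g h - (b 0%N + b 1%N * h)| <= D * `|h| ^+ 2.
  have := geo_tail_le (n := 2) q0 q1 _ (bg h he).
  rewrite !big_ord_recr big_ord0/= add0r expr0 mulr1 expr1 => H.
  apply: le_trans (H C _) _ => [k _|].
    rewrite normrM normrX /q expr_div_n mulrA ler_pdivlMr ?exprn_gt0//.
    by rewrite mulrAC ler_wpM2r ?exprn_ge0.
  have -> : D * `|h| ^+ 2 = C * q ^+ 2 * 2 by rewrite /D /q expr_div_n; ring.
  by apply: ler_wpM2l => //; apply: mulr_ge0 => //; exact: exprn_ge0.
rewrite (psum_at0 bg e0).
have -> : b 1%N - h^-1 *: (g h - b 0%N : K^o) = - (h^-1 * (g h - (b 0%N + b 1%N * h))).
  rewrite opprD addrA [in RHS]mulrBr mulrCA mulVf// mulr1 opprB.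
  by congr (_ - _).
rewrite normrN normrM normfV mulrC ltr_pdivrMr//.
apply: le_lt_trans T _; rewrite expr2 mulrA ltr_pM2r//.
apply: (@le_lt_trans _ _ (`|h| * (D + 1))); last by rewrite -ltr_pdivlMr.
by rewrite mulrC ler_wpM2l// lerDl.
Unshelve. all: by end_near. Qed.

(** The derivative at [z] is the coefficient of degree 1 in the expansion recentered at [z]. *)
Lemma psum_derive_cvg a d f z : psum a d f -> `|z| < d ->
  exists2 l : K^o, has_sum (fun j => (a j.+1 * z ^+ j) *+ j.+1 : K^o) l &
    h^-1 *: (f (h + z) - f z : K^o) @[h --> 0^'] --> l.
Proof.
move=> af zd; have [b bf Hb] := psum_reexpand af zd.
exists (b 1%N).
  by apply: eq_has_sum (Hb 1%N) => j; rewrite /recoef bin1 add1n.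
have d0 : 0 < d - `|z| by rewrite subr_gt0.
refine (eq_cvg_to _ (psum_derive_at0 bf d0)) => h.
by rewrite addr0 [h + z]addrC.
Qed.

Lemma psum_derive1 a d f : psum a d f ->
  psum (fun j => a j.+1 *+ j.+1) d (derive1 (f : K -> K^o)).
Proof.
move=> af z zd; have [l ls lc] := psum_derive_cvg af zd.
have -> : derive1 (f : K -> K^o) z = l by apply: cvg_lim lc.
by apply: eq_has_sum ls => j; rewrite mulrnAl.
Qed.

Definition dcoef (a : nat -> K) (k j : nat) : K := a (k + j)%N *+ (k + j) ^_ k.

Lemma dcoef0 a : dcoef a 0 =1 a.
Proof. by move=> j; rewrite /dcoef ffactn0. Qed.

Lemma dcoefS a k j : dcoef a k.+1 j = dcoef a k j.+1 *+ j.+1.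
Proof. by rewrite /dcoef ffactnSr mulrnA addSnnS addKn. Qed.

Lemma eq_psum a b d f : a =1 b -> psum a d f -> psum b d f.
Proof. by move=> /funext ->. Qed.

Lemma psum_derive1n a d f k : psum a d f ->
  psum (dcoef a k) d (derive1n k (f : K -> K^o)).
Proof.
move=> af; elim: k => [|k IH]; first by apply: eq_psum af => j; rewrite dcoef0.
by rewrite derive1nS; apply: eq_psum (psum_derive1 IH) => j; rewrite dcoefS.
Qed.

Lemma psum_derive1n0 a d f k : psum a d f -> 0 < d ->
  derive1n k (f : K -> K^o) 0 = a k *+ k`!.
Proof.
move=> af d0; rewrite (psum_at0 (psum_derive1n (k := k) af) d0).
by rewrite /dcoef addn0 ffactnn.
Qed.

(** Both coefficient sequences are recovered from the derivatives of [f] at 0, and [k!] is nonzero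
    in characteristic 0. *)
Lemma psum_unique a b d e f : psum a d f -> psum b e f -> 0 < d -> 0 < e -> a =1 b.
Proof.
move=> af bf d0 e0 k; have := psum_derive1n0 k af d0.
rewrite (psum_derive1n0 k bf e0) => /eqP; rewrite -subr_eq0 -mulrnBl mulrn_eq0.
by rewrite gtn_eqF ?fact_gt0//= subr_eq0 => /eqP.
Qed.

End Complete.

(** * Entrywise limits and derivatives of matrix functions *)

Section MatrixLimits.
Variables (K : numFieldType) (m n : nat).

Lemma cvg_mxP (T : Type) (F : set_system T) (FF : Filter F) (g : T -> 'M[K]_(m, n))
    (l : 'M[K]_(m, n)) :
  g @ F --> l <-> forall i j, g x i j @[x --> F] --> (l i j : K^o).
Proof.
split=> [gl i j|gl].
  apply/cvgrPdist_lt => e e0; have /cvg_ball/(_ e e0) := gl.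
  by apply: filterS => x [_ /(_ i j)].
apply/cvg_ballP => e e0.
have : \forall x \near F, forall ij : 'I_m * 'I_n, `|l ij.1 ij.2 - g x ij.1 ij.2| < e.
  apply: filter_forall => -[i j].
  by have /cvgrPdist_lt/(_ e e0) := gl i j.
by apply: filterS => x H; split=> // i j; exact: (H (i, j)).
Qed.

Lemma has_sum_mxP (A : nat -> 'M[K]_(m, n)) (s : 'M[K]_(m, n)) :
  has_sum A s <-> forall i j, @has_sum K K^o (fun k => A k i j) (s i j).
Proof.
rewrite /has_sum; split=> [/cvg_mxP H i j|H].
  by refine (eq_cvg_to _ (H i j)) => N; rewrite summxE.
apply/cvg_mxP => i j; refine (eq_cvg_to _ (H i j)) => N.
by rewrite summxE.
Qed.

Hypothesis Kc : geo_complete K.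

Lemma mx_derive1n (A : nat -> 'M[K]_(m, n)) d (g : K -> 'M[K]_(m, n)) k :
  (forall i j, psum (fun k => A k i j) d (fun z => g z i j)) ->
  forall i j, psum (dcoef (fun k => A k i j) k) d (fun z => derive1n k g z i j).
Proof.
move=> Ag; elim: k => [|k IH] i j.
  by apply: eq_psum (Ag i j) => l; rewrite dcoef0.
move=> z zd.
(* The matrix derivative is a limit of whole matrices, so one entry can be read off only once all
   entries converge; hence a limit is chosen for every entry. *)
pose l i j := sval (cid2 (psum_derive_cvg Kc (IH i j) zd)).
have lP i' j' := svalP (cid2 (psum_derive_cvg Kc (IH i' j') zd)).
have -> : derive1n k.+1 g z i j = l i j.
  rewrite derive1nS.
  suff -> : derive1 (derive1n k g) z = \matrix_(i, j) l i j by rewrite mxE.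
  apply: cvg_lim => //; apply/cvg_mxP => i' j'; rewrite mxE.
  have [_ H] := lP i' j'.
  by refine (eq_cvg_to _ H) => h; rewrite !mxE.
have [H _] := lP i j.
by refine (eq_has_sum _ H) => k'; rewrite dcoefS [RHS]mulrnAl.
Qed.

Lemma mx_derive1n0 (A : nat -> 'M[K]_(m, n)) d (g : K -> 'M[K]_(m, n)) k :
  (forall i j, psum (fun k => A k i j) d (fun z => g z i j)) -> 0 < d ->
  derive1n k g 0 = A k *+ k`!.
Proof.
move=> Ag d0; apply/matrixP => i j; rewrite mulmxnE.
rewrite (psum_at0 (@mx_derive1n A d g k Ag i j) d0).
by rewrite /dcoef addn0 ffactnn.
Qed.

End MatrixLimits.

(** * Analytic functions on a disc *)

Section ComplexComplete.
Variable R : realType.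
Local Notation C := R[i].

Lemma geo_complete_real : geo_complete R.
Proof.
move=> u c q q0 q1 uc.
have /cvg_ex[l /= ul] : cvgn (series (u : R^nat)).
  apply: normed_cvg.
  apply: (@series_le_cvg _ _ (geometric c q)) => //=.
  - by move=> k; apply: le_trans (uc k).
  - by apply: is_cvg_geometric_series; rewrite ger0_norm.
exists l; refine (eq_cvg_to _ ul) => n.
by rewrite /series/= big_mkord.
Qed.

Lemma normc_real (x : R) : `|x%:C| = `|x|%:C :> C.
Proof.
have [x0|x0] := leP 0 x; first by rewrite !ger0_norm ?ler0c.
by rewrite (ltr0_norm x0) -normrN -rmorphN ger0_norm// ler0c oppr_ge0 ltW.
Qed.

Lemma ge0_complexE (z : C) : 0 <= z -> z = (complex.Re z)%:C.
Proof. by case: z => a b; rewrite lecE /= => /andP[/eqP -> _]. Qed.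

Lemma cvg_real_complex (T : Type) (F : set_system T) (FF : Filter F) (u : T -> R) (l : R) :
  u @ F --> (l : R^o) -> (fun x => (u x)%:C) @ F --> (l%:C : C^o).
Proof.
move=> /cvgrPdist_lt ul; apply/(@cvgrPdist_lt _ C^o) => e e0.
have er : 0 < complex.Re e by have := e0; rewrite ltcE => /andP[].
apply: filterS (ul _ er) => x H.
by rewrite -rmorphB normc_real (ge0_complexE (ltW e0)) ltcR.
Qed.

Lemma normc_ge_ReC (z : C) : `|(complex.Re z)%:C| <= `|z|.
Proof. by rewrite normc_real normc_ge_Re. Qed.

Lemma normc_ge_ImC (z : C) : `|(complex.Im z)%:C| <= `|z|.
Proof.
have -> : (complex.Im z) = complex.Re (- ('i * z)) by case: z => a b /=; simpc.
apply: le_trans (normc_ge_ReC _) _; rewrite normrN normrM.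
suff -> : `|'i : C| = 1 by rewrite mul1r.
by rewrite normc_def /= expr0n /= add0r expr1n sqrtr1.
Qed.

Lemma has_sum_real_complex (u : nat -> R) (l : R) :
  @has_sum R R^o u l -> @has_sum C C^o (fun k => (u k)%:C) l%:C.
Proof.
move=> ul; refine (@eq_cvg_to C C^o nat \oo _ _ _ _ (cvg_real_complex _ ul)) => n.
by rewrite rmorph_sum.
Qed.

Lemma geo_complete_complex : geo_complete C.
Proof.
move=> u c q q0 q1 uc.
have c0 : 0 <= c by have := le_trans (normr_ge0 _) (uc 0%N); rewrite expr0 mulr1.
have qr0 : 0 <= complex.Re q by have := q0; rewrite {1}(ge0_complexE q0) ler0c.
have qr1 : complex.Re q < 1 by rewrite -ltcR -(ge0_complexE q0).
have bR k : `|complex.Re (u k)| <= complex.Re c * complex.Re q ^+ k.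
  rewrite -lecR -normc_real rmorphM rmorphXn/= -(ge0_complexE q0) -(ge0_complexE c0).
  exact: le_trans (normc_ge_ReC _) (uc k).
have bI k : `|complex.Im (u k)| <= complex.Re c * complex.Re q ^+ k.
  rewrite -lecR -normc_real rmorphM rmorphXn/= -(ge0_complexE q0) -(ge0_complexE c0).
  exact: le_trans (normc_ge_ImC _) (uc k).
have [sR HR] := geo_complete_real qr0 qr1 bR.
have [sI HI] := geo_complete_real qr0 qr1 bI.
exists (sR%:C + 'i * sI%:C).
refine (eq_has_sum _ (has_sumD (has_sum_real_complex HR)
  (has_sumZ (a := 'i) (has_sum_real_complex HI)))) => k.
by rewrite [RHS]complexE.
Qed.

End ComplexComplete.

(** * Cauchy's estimate by roots of unity *)

Section CauchyEstimate.
Variable R : realType.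
Local Notation C := R[i].

(** In characteristic 0 [X^n - 1] is separable, so it has [n] distinct roots, and [n] distinct n-th
    roots of unity include a primitive one. *)
Lemma exists_prim_root (n : nat) : (0 < n)%N -> exists w : C, n.-primitive_root w.
Proof.
move=> n0; pose p : {poly C} := 'X^n - 1.
have [r Dp] := closed_field_poly_normal p.
move: Dp; rewrite (monicP _) ?monicXnsubC// scale1r => Dp.
have rn1 : all n.-unity_root r by apply/allP => z; rewrite -root_prod_XsubC -Dp.
have szr : (n < (size r).+1)%N.
  by rewrite -(size_prod_XsubC r id) -Dp size_XnsubC.
have [|z] := hasP (cyclic.has_prim_root n0 rn1 _ szr); last by exists z.
by rewrite -separable.separable_prod_XsubC -Dp cyclotomic.separable_Xn_sub_1// pnatr_eq0 -lt0n.
Qed.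

(** For [j != k] the ratio [v = w^j / w^k] is an n-th root of unity other than 1, so its geometric
    sum vanishes. *)
Lemma prim_root_sum (n j k : nat) (w : C) : n.-primitive_root w ->
  (j < n)%N -> (k < n)%N ->
  \sum_(l < n) (w ^+ l) ^+ j / (w ^+ l) ^+ k = (j == k)%:R * n%:R.
Proof.
move=> wn jn kn.
have w0 : w != 0 by rewrite (prim_root_eq0 wn) -lt0n (leq_ltn_trans _ jn).
pose v := w ^+ j / w ^+ k.
have E l : (w ^+ l) ^+ j / (w ^+ l) ^+ k = v ^+ l.
  by rewrite /v expr_div_n -!exprM ![(l * _)%N]mulnC.
have [jk|jk] := eqVneq j k.
  rewrite mul1r (eq_bigr (fun=> 1)) ?sumr_const ?card_ord// => l _.
  by rewrite E /v jk divff ?expf_neq0// expr1n.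
rewrite mul0r (eq_bigr (fun l : 'I_n => v ^+ l)) => [|l _]; last exact: E.
have v1 : v - 1 != 0.
  rewrite subr_eq0; apply: contra_neq jk => vj.
  have : w ^+ j == w ^+ k.
    by rewrite -[w ^+ j](divfK (x := w ^+ k)) ?expf_neq0// -/v vj mul1r.
  by rewrite (eq_prim_root_expr wn) !modn_small// => /eqP.
have vn : v ^+ n = 1.
  rewrite /v expr_div_n -!exprM ![(_ * n)%N]mulnC !exprM (prim_expr_order wn).
  by rewrite !expr1n divr1.
by apply: (mulfI v1); rewrite -subrX1 vn subrr mulr0.
Qed.

(* For [n > k], averaging the partial sum of order [n] times [w^(-lk)] over the
   n-th roots of unity isolates [a k * r ^+ k]; the tail is arbitrarily small. *)
Lemma cauchy_estimate (a : nat -> C) d (f : C -> C) (r B : C) :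
  psum a d f -> 0 <= r -> r < d -> (forall z, `|z| = r -> `|f z| <= B) ->
  forall k, `|a k| * r ^+ k <= B.
Proof.
move=> af r0 rd fB k.
have B0 : 0 <= B by apply: le_trans (normr_ge0 _) (fB r _); rewrite ger0_norm.
have X0 : 0 <= `|a k| * r ^+ k by rewrite mulr_ge0// exprn_ge0.
rewrite real_leNgt ?ger0_real//; apply/negP => H.
have e0 : 0 < `|a k| * r ^+ k - B by rewrite subr_gt0.
(* [e] is the excess if the estimate fails. Below, [n] is taken so large that the tail on [|z| = r]
   is below [e], and larger than [k] so that the average isolates degree [k]. *)
set e := _ - B in e0.
have [s rs sd] := lt_between rd.
have s0 : 0 < s by apply: le_lt_trans rs.
have [c c0 Hc] := psum_bounded af (ltW s0) sd.
pose q := r / s.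
have q0 : 0 <= q by rewrite divr_ge0// ltW.
have q1 : q < 1 by rewrite ltr_pdivrMr// mul1r.
have q1' : 0 <= 1 - q by rewrite subr_ge0 ltW.
have [n0 Hn0] := geo_cvg0 (@geo_complete_complex R) (divr_ge0 c0 q1') q0 q1 e0.
pose n := maxn n0 k.+1.
have kn : (k < n)%N by rewrite leq_max ltnSn orbT.
have tail z : `|z| = r -> `|f z - \sum_(j < n) a j * z ^+ j| < e.
  move=> zr; apply: le_lt_trans (Hn0 n _); last by rewrite leq_maxl.
  have zd : `|z| < d by rewrite zr.
  rewrite mulrAC; apply: (geo_tail_le q0 q1 _ (af z zd)) => j _.
  rewrite normrM normrX zr /q expr_div_n mulrA ler_pdivlMr ?exprn_gt0//.
  by rewrite mulrAC ler_wpM2r ?exprn_ge0.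
have n_gt0 : (0 < n)%N by apply: leq_ltn_trans kn.
have [w wn] := exists_prim_root n_gt0.
have w1 : `|w| = 1.
  apply/eqP; rewrite -(@pexpr_eq1 _ _ n)//.
  by rewrite -normrX (prim_expr_order wn) normr1.
have zr l : `|r * w ^+ l| = r by rewrite normrM normrX w1 expr1n mulr1 ger0_norm.
have S : \sum_(l < n) (\sum_(j < n) a j * (r * w ^+ l) ^+ j) / (w ^+ l) ^+ k
    = n%:R * (a k * r ^+ k).
  under eq_bigr do rewrite mulr_suml; rewrite exchange_big/=.
  rewrite (eq_bigr (fun j : 'I_n => a j * r ^+ j * ((val j == k)%:R * n%:R))); last first.
    move=> j _; rewrite -(prim_root_sum (j := val j) (k := k) wn) ?ltn_ord// mulr_sumr; apply: eq_bigr => l _.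
    by rewrite exprMn !mulrA.
  rewrite (bigD1 (Ordinal kn))//= eqxx mul1r mulrC big1 ?addr0// => j jk.
  by rewrite -val_eqE/= in jk; rewrite (negPf jk) mul0r mulr0.
(* Each of the [n] terms of the sum has norm below [B + e = |a k| r^k], which is absurd. *)
have : n%:R * (`|a k| * r ^+ k) < n%:R * (`|a k| * r ^+ k).
  rewrite -[X in X < _](ger0_norm (x := n%:R * _)) ?mulr_ge0 ?exprn_ge0//.
  have -> : `|n%:R * (`|a k| * r ^+ k)| = `|n%:R * (a k * r ^+ k)|.
    by rewrite !normrM !normr_id.
  rewrite -S; apply: le_lt_trans (ler_norm_sum _ _ _) _.
  have -> : n%:R * (`|a k| * r ^+ k) = \sum_(l < n) (B + e).
    by rewrite sumr_const card_ord /e addrC subrK mulr_natl.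
  apply: ltr_sum => [|l _]; first by apply/hasP; exists (Ordinal n_gt0); rewrite ?mem_index_enum.
  rewrite normrM normfV !normrX w1 !expr1n invr1 mulr1.
  rewrite -[X in `|X|](subKr (f (r * w ^+ l))).
  apply: le_lt_trans (ler_normB _ _) _.
  by rewrite ler_ltD ?fB ?tail.
by rewrite ltxx.
Qed.

End CauchyEstimate.

Section PsumExtra.
Variable K : numFieldType.
Hypothesis Kc : geo_complete K.

Lemma psum_mono (a : nat -> K) d e f : e <= d -> psum a d f -> psum a e f.
Proof. by move=> ed af z ze; apply: af; apply: lt_le_trans ze ed. Qed.

Lemma psum_eq_on (a : nat -> K) d f g : (forall z, `|z| < d -> f z = g z) ->
  psum a d f -> psum a d g.
Proof. by move=> fg af z zd; rewrite -fg//; exact: af. Qed.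

Lemma psum_series_sum (a : nat -> K) d :
  (forall r, 0 <= r -> r < d -> exists C, forall k, `|a k| * r ^+ k <= C) ->
  psum a d (fun z => @series_sum K K^o (fun k => a k * z ^+ k)).
Proof.
move=> H z zd; have [s us] := psum_of_bounded Kc H zd.
by rewrite (series_sumE us).
Qed.

(** The numbers [(n + 1) q^n] are the terms of the differentiated geometric series, which converges
    at [q]. *)
Lemma geo_linear_bounded (q : K) : 0 <= q -> q < 1 ->
  exists2 C, 0 <= C & forall n, n.+1%:R * q ^+ n <= C.
Proof.
move=> q0 q1.
have H : psum (fun=> 1) 1 (fun z => @series_sum K K^o (fun k => 1 * z ^+ k)).
  apply: psum_series_sum => r r0 r1; exists 1 => k.
  by rewrite normr1 mul1r exprn_ile1// ltW.
have [|l ls _] := psum_derive_cvg Kc (z := q) H; first by rewrite ger0_norm.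
have [C C0 HC] := has_sum_bounded ls; exists C => // n.
apply: le_trans (HC n); rewrite mul1r mulr_natl ger0_norm//.
by rewrite mulrn_wge0// exprn_ge0.
Qed.

End PsumExtra.

(** * Convergence of the Taylor series on the whole disc *)

Section Analytic.
Variable R : realType.
Local Notation C := R[i].
Let Cc := @geo_complete_complex R.
Implicit Types (f : C -> C).

Lemma normc_Re (z : C) : `|z| = (complex.Re `|z|)%:C.
Proof. exact: ge0_complexE. Qed.

Lemma analytic_local r f w : analytic_on_disc r f -> in_disc r w ->
  exists (b : nat -> C) (e : R), 0 < e /\ psum b e%:C (fun h => f (w + h)).
Proof.
move=> af /af [b [e [e0 H]]]; exists b, e; split=> // h he.
have := H (w + h); rewrite addrAC subrr add0r; exact.
Qed.

(* A single parameter [t] controls both the radius [t^-1] and the bound [t], so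
   that compactness can be applied along the filter [t --> +oo]. *)
Definition uniform_at (f : C -> C) (t : R) (z : C) : Prop :=
  (exists b, psum b (t^-1)%:C (fun h => f (z + h))) /\
  forall h, `|h| < (t^-1)%:C -> `|f (z + h)| <= t%:C.

(** If the expansion at [w] has radius [e], discs of radius [e / 4] about points within [e / 4] of
    [w] stay within [e / 2] of [w], where [f] has a geometric bound. *)
Lemma uniform_near r f w : analytic_on_disc r f -> in_disc r w ->
  exists2 e : R, 0 < e & exists t0 : R, forall t z, t0 <= t -> `|z - w| < e%:C ->
    uniform_at f t z.
Proof.
move=> af wr; have [b [e [e0 bf]]] := analytic_local af wr.
have e0' : (0 : C) < e%:C by rewrite ltcR.
have e2 : (e / 2)%:C < e%:C :> C by rewrite ltcR; lra.
have e2' : (0 : C) <= (e / 2)%:C by rewrite lecR; lra.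
have [s es se] := lt_between e2.
have s0 : 0 < s by apply: le_lt_trans es.
have [c c0 Hc] := psum_bounded bf (ltW s0) se.
have H (h : C) : `|h| <= (e / 2)%:C -> `|f (w + h)| <= c / (1 - (e / 2)%:C / s).
  move=> he; apply: (geo_has_sum_le _ _ _ (bf h (le_lt_trans he e2))).
  - by rewrite divr_ge0// ltW.
  - by rewrite ltr_pdivrMr// mul1r.
  move=> k; rewrite normrM normrX expr_div_n mulrA ler_pdivlMr ?exprn_gt0//.
  rewrite mulrAC; apply: ler_pM; rewrite ?mulr_ge0 ?exprn_ge0// ?(ltW s0)//.
  by rewrite lerXn2r ?nnegrE.
set B := c / _ in H.
have B0 : 0 <= B by apply: le_trans (normr_ge0 _) (H 0 _); rewrite normr0.
exists (e / 4); first by lra.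
(* The first argument makes [t] dominate [f], the second gives [t^-1 <= e / 4]. *)
exists (Num.max (complex.Re B) (4 / e)) => t z.
rewrite ge_max => /andP[tB te] zw.
have t0 : 0 < t by apply: lt_le_trans te; rewrite divr_gt0.
have te' : t^-1 <= e / 4 by rewrite -[leRHS]invrK lef_pV2 ?posrE ?invr_gt0 ?divr_gt0// invf_div.
have bt : `|z - w| + (t^-1)%:C < (e / 2)%:C.
  have -> : (e / 2)%:C = (e / 4)%:C + (e / 4)%:C :> C by rewrite -rmorphD; congr (_%:C); lra.
  by rewrite ltr_leD// lecR.
split.
  have zwe : `|z - w| < e%:C by apply: lt_trans zw _; rewrite ltcR; lra.
  have [b' b'f _] := psum_reexpand Cc bf zwe; exists b'.
  apply: psum_mono (psum_eq_on _ b'f) => [|h _]; last first.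
    by congr f; rewrite addrA [w + _]addrC subrK.
  by rewrite lerBrDl ltW// (lt_trans bt e2).
move=> h ht; have -> : z + h = w + (z - w + h) by rewrite addrA [w + _]addrC subrK.
apply: le_trans (H _ _) _; last by rewrite (ge0_complexE B0) lecR.
by apply: le_trans (ler_normD _ _) _; rewrite ltW// (lt_trans _ bt)// ltrD2l.
Qed.

Lemma normc_le_ReIm (a b : R) : `|a +i* b| <= (`|a| + `|b|)%:C :> C.
Proof.
rewrite [_ +i* _]complexE /= (le_trans (ler_normD _ _))// normrM !normc_real.
suff -> : `|'i : C| = 1 by rewrite mul1r rmorphD.
by rewrite normc_def /= expr0n /= add0r expr1n sqrtr1.
Qed.

(** Compactness along [t --> +oo] turns the local property into one with a single [t]. *)
Lemma uniform_closed_disc r r0 f : analytic_on_disc r f -> r0 < r ->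
  exists2 t : R, 0 < t & forall z, `|z| <= r0%:C -> uniform_at f t z.
Proof.
move=> af r0r.
(* The compact set is a square in the real plane; the disc enters as a premise of the property to be
   covered. *)
pose K : set (R * R) := `[- r0, r0] `*` `[- r0, r0].
have Kc : compact K by apply: compact_setX; exact: segment_compact.
move/compact_near_coveringP : Kc => /(_ R (+oo%R : set_system R)
  (fun t xy => `|xy.1 +i* xy.2| <= r0%:C -> uniform_at f t (xy.1 +i* xy.2)) _) [].
  move=> [x y] _ /=.
  have [xyr|xyr] := boolP (`|x +i* y| <= r0%:C).
    have wr : in_disc r (x +i* y) by rewrite /in_disc (le_lt_trans xyr)// ltcR.
    have [e e0 [t0 H]] := uniform_near af wr.
    exists (ball (x, y) (e / 2), [set t | t0 <= t]) => /=.
      split; first by apply: nbhsx_ballx; rewrite divr_gt0.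
      exact: nbhs_pinfty_ge (num_real _).
    move=> [[x' y'] t] /= [[xx yy] t0t] _; apply: H => //.
    have -> : x' +i* y' - (x +i* y) = (x' - x) +i* (y' - y) by simpc.
    apply: le_lt_trans (normc_le_ReIm _ _) _; rewrite ltcR (splitr e).
    by apply: ltrD; rewrite distrC.
  (* Off the closed disc the premise fails on a whole neighbourhood, of half the gap in each
     coordinate, so the implication is vacuous there. *)
  set nw := complex.Re `|x +i* y|.
  have nwE : `|x +i* y| = nw%:C by exact: normc_Re.
  have nwr : 0 < nw - r0 by move: xyr; rewrite nwE lecR -ltNge subr_gt0.
  exists (ball (x, y) ((nw - r0) / 2), setT) => /=.
    by split; [apply: nbhsx_ballx; rewrite divr_gt0|exact: filterT].
  move=> [[x' y'] t] /= [[xx yy] _] xyr'; exfalso.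
  have d1 : `|(x - x') +i* (y - y')| < (nw - r0)%:C.
    apply: le_lt_trans (normc_le_ReIm _ _) _; rewrite ltcR (splitr (nw - r0)).
    exact: ltrD.
  have := ler_normD (x' +i* y') ((x - x') +i* (y - y')).
  have -> : x' +i* y' + ((x - x') +i* (y - y')) = x +i* y.
    by simpc; rewrite ![_ + (_ - _)]addrC !subrK.
  rewrite nwE => /le_lt_trans => /(_ (r0%:C + (nw - r0)%:C)).
  by rewrite ler_ltD// => /(_ isT); rewrite -rmorphD addrC subrK ltxx.
move=> M [_ HM]; pose t := Num.max M 0 + 1.
have Mt : M < t by rewrite (le_lt_trans (y := Num.max M 0)) ?le_max ?lexx// ltrDl.
have Ht := HM t Mt.
exists t => [|z zr]; first by rewrite ltr_wpDl// le_max lexx orbT.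
rewrite [z]complexE.
have zE : (complex.Re z)%:C + 'i * (complex.Im z)%:C = complex.Re z +i* complex.Im z.
  by rewrite -complexE; case: (z).
rewrite zE; apply: (Ht (complex.Re z, complex.Im z)) => /=; last by rewrite -zE -complexE.
split=> /=; rewrite in_itv/= -ler_norml -lecR -normc_real; apply: le_trans zr.
  exact: normc_ge_ReC.
exact: normc_ge_ImC.
Qed.

(* Applying the Cauchy estimate at [z0] with [|z0| = rho < r0], then to the k-th
   recentered coefficient as a function of [z0], gives
   [|a n| 'C(n, k) rho^(n - k) e^k <= t]; these are summed over [k]. *)
Lemma psum_extend r r0 a f : analytic_on_disc r f -> 0 < r0 -> r0 < r ->
  psum a r0%:C f -> exists2 e : R, 0 < e & psum a (r0 + e)%:C f.
Proof.
move=> fa r00 r0r af.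
have [t t0 tu] := uniform_closed_disc fa r0r.
have ti0 : 0 < t^-1 by rewrite invr_gt0.
(* The radius [e] is strictly below [t^-1], as the Cauchy estimate requires; [2 e = t^-1] serves
   again in the continuation below. *)
pose e := t^-1 / 2; have e0 : 0 < e by rewrite divr_gt0.
have e0c : (0 : C) < e%:C by rewrite ltcR.
have ee : e + e = t^-1 by rewrite /e -splitr.
have et : e < t^-1 by lra.
have bn (rho : R) n k : 0 <= rho -> rho < r0 -> (k <= n)%N ->
    `|a n| *+ 'C(n, k) * rho%:C ^+ (n - k) * e%:C ^+ k <= t%:C.
  move=> rho0 rhor0 kn.
  have H (z : C) : `|z| < r0%:C -> exists2 b : nat -> C,
      `|b k| <= t%:C / e%:C ^+ k & @has_sum C C^o (recoef a z k) (b k).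
    move=> zr; have [b bf Hb] := psum_reexpand Cc af zr.
    have [[b' b'f] fB] := tu z (ltW zr).
    exists b => //.
    have -> : b k = b' k.
      by apply: (psum_unique Cc bf b'f); rewrite ?subr_gt0// ltcR.
    rewrite ler_pdivlMr ?exprn_gt0//.
    apply: (cauchy_estimate b'f); rewrite ?(ltW e0c) ?ltcR// => h he.
    by apply: fB; rewrite he ltcR.
  pose g z := @series_sum C C^o (recoef a z k).
  have gs : psum (fun j => a (k + j)%N *+ 'C(k + j, k)) r0%:C g.
    move=> z zr; have [b _ bs] := H z zr.
    rewrite /g (series_sumE bs); apply: eq_has_sum bs => j.
    by rewrite /recoef mulrnAl.
  have gB (z : C) : `|z| = rho%:C -> `|g z| <= t%:C / e%:C ^+ k.
    move=> zr; have [|b bB bs] := H z; first by rewrite zr ltcR.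
    by rewrite /g (series_sumE bs).
  have := cauchy_estimate gs _ _ gB (n - k)%N.
  rewrite subnKC// normrMn ler_pdivlMr ?exprn_gt0//; apply.
    by rewrite lecR.
  by rewrite ltcR.
have bd (rho : R) n : 0 <= rho -> rho < r0 ->
    `|a n| * (rho + e)%:C ^+ n <= n.+1%:R * t%:C.
  move=> rho0 rhor0; rewrite rmorphD exprDn mulr_sumr.
  rewrite mulr_natl -[X in _ <= _ *+ X]card_ord -sumr_const.
  apply: ler_sum => i _; rewrite mulrnAr -mulrnAl mulrA.
  by apply: bn => //; rewrite -ltnS.
have bd2 (s : C) : 0 <= s -> s < (r0 + e)%:C -> exists c, forall k, `|a k| * s ^+ k <= c.
  move=> s0 sr; rewrite (ge0_complexE s0); rewrite (ge0_complexE s0) ltcR in sr.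
  have sg0 : 0 <= complex.Re s by rewrite -lecR -(ge0_complexE s0).
  set sg := complex.Re s in sr sg0 *.
  (* With [rho] so close to [r0] that [s < rho + e], the ratio is below 1 and absorbs the factor
     [n + 1]. *)
  have [rho rhol rhor0] : exists2 u : R, Num.max 0 (sg - e) < u & u < r0.
    by apply: lt_between; rewrite gt_max r00; lra.
  move: rhol; rewrite gt_max => /andP[rho0 rhos].
  have T0 : (0 : C) < (rho + e)%:C by rewrite ltcR; lra.
  have q0 : 0 <= sg%:C / (rho + e)%:C by rewrite divr_ge0// ?(ltW T0)// lecR.
  have q1 : sg%:C / (rho + e)%:C < 1 by rewrite ltr_pdivrMr// mul1r ltcR; lra.
  have [c c0 Hc] := geo_linear_bounded Cc q0 q1.
  exists (t%:C * c) => k.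
  have -> : sg%:C = (rho + e)%:C * (sg%:C / (rho + e)%:C).
    by rewrite mulrC divfK// gt_eqF.
  rewrite exprMn mulrA.
  apply: (@le_trans _ _ (k.+1%:R * t%:C * (sg%:C / (rho + e)%:C) ^+ k)).
    by apply: ler_wpM2r; [exact: exprn_ge0|apply: bd => //; exact: ltW].
  by rewrite [_ * t%:C]mulrC -mulrA ler_wpM2l// lecR ltW.
(* Convergence on the larger disc does not yet identify the sum [F_] with [f]; they are compared
   through their expansions at a point of the old disc. *)
have [F_ F] : exists F_, psum a (r0 + e)%:C F_.
  have F := psum_series_sum Cc bd2.
  by exists (fun z : C => @series_sum C C^o (fun k => a k * z ^+ k)).
exists e; first exact: e0.
refine (psum_eq_on _ F) => z zr.
have Ff (y : C) : `|y| < r0%:C -> F_ y = f y.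
  move=> yr; apply: has_sum_unique (F y _) (af y yr).
  by apply: lt_trans yr _; rewrite ltcR; lra.
have [zr0|zr0] := boolP (`|z| < r0%:C); first exact: Ff.
(* [u > r0 - e] puts [z0], the point of norm [u] on the segment from 0 to [z], at distance less than
   [2 e = t^-1] from [z]. *)
have [u ur ur0] : exists2 u : R, Num.max 0 (r0 - e) < u & u < r0.
  by apply: lt_between; rewrite gt_max r00; lra.
move: ur; rewrite gt_max => /andP[u0 ur].
set nz := complex.Re `|z|.
have nzE : `|z| = nz%:C by exact: normc_Re.
have nzr : nz < r0 + e by rewrite -ltcR -nzE.
have rnz : r0 <= nz by rewrite leNgt -ltcR -nzE.
have nz0 : 0 < nz by lra.
have nzc0 : nz%:C != 0 :> C by rewrite gt_eqF// ltcR.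
pose z0 := z * (u%:C / nz%:C); pose h := z - z0.
have z0u : `|z0| = u%:C.
  rewrite normrM normf_div !normc_real (gtr0_norm u0) (gtr0_norm nz0) nzE.
  by rewrite mulrC divfK.
have hu : `|h| = (nz - u)%:C.
  have -> : h = z * ((nz - u)%:C / nz%:C).
    by rewrite /h /z0 rmorphB mulrBl divff// mulrBr mulr1.
  have nzu0 : 0 < nz - u by lra.
  rewrite normrM normf_div !normc_real (gtr0_norm nzu0) (gtr0_norm nz0) nzE.
  by rewrite mulrC divfK.
have zE : z = z0 + h by rewrite /h addrC subrK.
have [|[b' b'f] _] := tu z0; first by rewrite z0u lecR; lra.
have [|b'' b''F _] := psum_reexpand Cc F (z0 := z0); first by rewrite z0u ltcR; lra.
have ru0 : (0 : C) < (r0 - u)%:C by rewrite ltcR; lra.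
have b''f : psum b'' (r0 - u)%:C (fun h => f (z0 + h)).
  apply: psum_eq_on (psum_mono _ b''F) => [y yr|].
    apply: Ff; apply: le_lt_trans (ler_normD _ _) _.
    by rewrite z0u -ltrBrDl -rmorphB.
  by rewrite z0u -rmorphB lecR; lra.
(* Both expansions at [z0] represent [f] for [|h| < r0 - u], hence have the same coefficients. *)
have bb : b'' = b'.
  by apply/funext => k; apply: (psum_unique Cc b''f b'f) => //; rewrite ltcR.
rewrite zE; apply: has_sum_unique (b''F h _) _.
  by rewrite hu z0u -rmorphB ltcR; lra.
by rewrite bb; apply: b'f; rewrite hu ltcR; lra.
Qed.

(** The supremum of the radii up to [r] on which the Taylor series represents [f] is attained
    because the discs are open; by [psum_extend] it cannot be less than [r]. *)
Theorem analytic_disc_psum r f : 0 < r -> analytic_on_disc r f -> exists a, psum a r%:C f.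
Proof.
move=> r_gt0 fa.
have [|a [d [d0 af]]] := analytic_local (w := 0) fa; first by rewrite /in_disc normr0 ltcR.
have {}af : psum a d%:C f by apply: psum_eq_on af => z _; rewrite add0r.
exists a.
pose E := [set t : R | [/\ 0 < t, t <= r & psum a t%:C f]].
have hE : has_sup E.
  split; last by exists r => t [].
  exists (Num.min d r); split; first by rewrite lt_min d0.
    by rewrite ge_min lexx orbT.
  by apply: psum_mono af; rewrite lecR ge_min lexx.
have sr : sup E <= r by apply: ge_sup; [exact: hE.1|move=> t []].
have sE : psum a (sup E)%:C f.
  move=> z; rewrite (normc_Re z) ltcR => zs.
  have [t [_ _ tf] zt] := sup_adherent (eps := sup E - complex.Re `|z|) (ltac:(by rewrite subr_gt0)) hE.
  by apply: tf; rewrite (normc_Re z) ltcR; move: zt; rewrite opprB addrC subrK.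
have s0 : 0 < sup E.
  have [t Et] := hE.1; apply: lt_le_trans (ub_le_sup hE.2 Et); by case: Et.
move: sr; rewrite le_eqVlt => /predU1P[<- //|sr].
have [e e0 He] := psum_extend fa s0 sr sE.
have : Num.min (sup E + e) r <= sup E.
  apply: (ub_le_sup hE.2); split.
  - by rewrite lt_min r_gt0 addr_gt0.
  - by rewrite ge_min lexx orbT.
  - by apply: psum_mono He; rewrite lecR ge_min lexx.
by rewrite ge_min => /orP[|]; lra.
Qed.

End Analytic.

(** * Matrix powers and matrix series *)

Section MatrixPowers.
Variable R : realType.
Local Notation C := R[i].

(* Removing one factor [S - z] at a time, [u_k = S^k A] satisfies a recurrence
   [u_(k+1) = z u_k + v_k] where [v_k] is already [O(rho^k)] and [|z| < rho]. *)
Lemma annihilated_power_bound (q : nat) (S : 'M[C]_q.+1) (rho : C) (rs : seq C)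
    (A : 'M[C]_q.+1) :
  (forall z, z \in rs -> `|z| < rho) ->
  horner_mx S (\prod_(z <- rs) ('X - z%:P)) *m A = 0 ->
  exists2 c : C, 0 <= c & forall k i j, `|(S ^+ k *m A) i j| <= c * rho ^+ k.
Proof.
elim: rs A => [|z rs IH] A rsr.
  rewrite big_nil rmorph1 mul1mx => ->; exists 0 => // k i j.
  by rewrite mulmx0 mxE normr0 mul0r.
rewrite big_cons mulrC rmorphM/= -mulmxA.
rewrite rmorphB/= horner_mx_X horner_mx_C => HA.
have zr : `|z| < rho by apply: rsr; rewrite mem_head.
have rho0 : 0 < rho by apply: le_lt_trans zr.
have [|c' c'0 Hc'] := IH _ _ HA; first by move=> y yr; apply: rsr; rewrite in_cons yr orbT.
have rz : 0 < rho - `|z| by rewrite subr_gt0.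
have s0 : 0 <= \sum_i \sum_j `|A i j| by apply: sumr_ge0 => i _; apply: sumr_ge0.
have c0 : 0 <= c' / (rho - `|z|) by rewrite divr_ge0// ltW.
(* The first summand settles [k = 0]; the second gives [c |z| + c' <= c rho], which is the induction
   step. *)
exists (\sum_i \sum_j `|A i j| + c' / (rho - `|z|)); first exact: addr_ge0.
elim=> [|k IHk] i j.
  rewrite mul1mx expr0 mulr1; apply: le_trans (_ : _ <= \sum_i \sum_j `|A i j|) _.
    rewrite (bigD1 i)//= (bigD1 j)//= -addrA lerDl addr_ge0// sumr_ge0// => i' _.
    exact: sumr_ge0.
  by rewrite lerDl.
have -> : S ^+ k.+1 *m A = z *: (S ^+ k *m A) + S ^+ k *m ((S - z%:M) *m A).
  rewrite mulmxBl mulmxBr mul_scalar_mx -scalemxAr addrC subrK.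
  by rewrite exprSr mulmxA.
rewrite mxE [X in X + _]mxE; apply: le_trans (ler_normD _ _) _; rewrite normrM.
set c := _ + _ in IHk *.
apply: (@le_trans _ _ (`|z| * (c * rho ^+ k) + c' * rho ^+ k)).
  by apply: lerD => //; apply: ler_wpM2l.
rewrite mulrA -mulrDl exprS mulrA ler_wpM2r ?exprn_ge0 ?(ltW rho0)//.
rewrite [`|z| * _]mulrC -lerBrDl -mulrBr /c mulrDl divfK ?gt_eqF// lerDr.
by rewrite mulr_ge0// ltW.
Qed.

Lemma seq_disc_bound (r : R) (rs : seq C) : 0 < r ->
  (forall z, z \in rs -> `|z| < r%:C) ->
  exists rho : R, [/\ 0 < rho, rho < r & forall z, z \in rs -> `|z| < rho%:C].
Proof.
move=> r0; elim: rs => [|y rs IH] H.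
  by exists (r / 2); split=> //; lra.
have [|rho [rho0 rhor Hrho]] := IH.
  by move=> z zr; apply: H; rewrite in_cons zr orbT.
have yr : `|y| < r%:C by apply: H; rewrite mem_head.
pose ny := complex.Re `|y|.
have nyE : `|y| = ny%:C by apply: ge0_complexE.
rewrite nyE ltcR in yr.
exists (Num.max rho ((ny + r) / 2)); split.
- by rewrite lt_max rho0.
- by rewrite gt_max rhor /=; lra.
move=> z; rewrite in_cons => /predU1P[->|/Hrho zr].
  by rewrite nyE ltcR lt_max; apply/orP; right; lra.
by apply: lt_le_trans zr _; rewrite lecR le_max lexx.
Qed.

(** By Cayley-Hamilton the split characteristic polynomial annihilates [S], and its finitely many
    roots, the eigenvalues, lie in a disc of radius [rho < r]. *)
Lemma mx_power_bound (r : R) (p : nat) (S : 'M[C]_p) : 0 < r ->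
  (forall a, eigenvalue S a -> in_disc r a) ->
  exists (rho : R) (c : C), [/\ 0 < rho, rho < r, 0 <= c &
    forall k i j, `|(S ^+ k) i j| <= c * rho%:C ^+ k].
Proof.
case: p S => [|q] S r0 HS.
  by exists (r / 2), 0; split=> //; [lra|lra|move=> k []].
have [rs Drs] := closed_field_poly_normal (char_poly S).
move: Drs; rewrite (monicP (char_poly_monic S)) scale1r => Drs.
have [|rho [rho0 rhor Hrho]] := seq_disc_bound (rs := rs) r0.
  by move=> z zr; apply: HS; rewrite eigenvalue_root_char Drs root_prod_XsubC.
have [||c c0 Hc] := @annihilated_power_bound q S rho%:C rs 1%:M => //.
  by rewrite -Drs Cayley_Hamilton mul0mx.
by exists rho, c; split=> // k i j; have := Hc k i j; rewrite mulmx1.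
Qed.

End MatrixPowers.

Section MatrixSeries.
Variable K : numFieldType.

Lemma has_sum_mulmxl (a b c : nat) (L : 'M[K]_(a, b)) (A : nat -> 'M[K]_(b, c)) s :
  has_sum A s -> has_sum (fun k => L *m A k) (L *m s).
Proof.
move=> /has_sum_mxP As; apply/has_sum_mxP => i j; rewrite mxE.
refine (eq_has_sum _ (has_sum_big (fun l => has_sumZ (a := L i l) (As l j)))) => k.
by rewrite mxE.
Qed.

Lemma has_sum_mulmxr (a b c : nat) (L : 'M[K]_(b, c)) (A : nat -> 'M[K]_(a, b)) s :
  has_sum A s -> has_sum (fun k => A k *m L) (s *m L).
Proof.
move=> /has_sum_mxP As; apply/has_sum_mxP => i j; rewrite mxE.
have -> : \sum_l s i l * L l j = \sum_l L l j * s i l by apply: eq_bigr => l _; rewrite mulrC.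
refine (eq_has_sum _ (has_sum_big (fun l => has_sumZ (a := L l j) (As i l)))) => k.
by rewrite mxE; apply: eq_bigr => l _; exact: mulrC.
Qed.

Lemma mx_geo_has_sum (Kc : geo_complete K) (m n : nat) (A : nat -> 'M[K]_(m, n)) (c q : K) :
  0 <= q -> q < 1 -> (forall k i j, `|A k i j| <= c * q ^+ k) -> exists s, has_sum A s.
Proof.
move=> q0 q1 H.
have ex (ij : 'I_m * 'I_n) : exists s : K^o, has_sum (fun k => A k ij.1 ij.2 : K^o) s.
  by apply: (Kc _ c q q0 q1) => k; exact: H.
have [s Hs] := choice ex.
exists (\matrix_(i, j) s (i, j)); apply/has_sum_mxP => i j; rewrite mxE.
exact: (Hs (i, j)).
Qed.

End MatrixSeries.
Arguments has_sum_mulmxl {K a b c} L {A s}.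
Arguments has_sum_mulmxr {K a b c} L {A s}.

(** * Convergence of the exponential tail; real and imaginary parts *)

Section ExpTail.
Variable R : realType.
Local Notation C := R[i].

Lemma expr_fact_le (x : R) k : 0 <= x -> x ^+ k / k`!%:R <= expR x.
Proof.
move=> x0; case: k => [|k].
  by rewrite expr0 fact0 divr1 (le_trans _ (expR_ge1Dx x))// lerDl.
by rewrite (le_trans _ (expR_ge1Dxn k x0))// lerDr.
Qed.

Lemma exprZ_mx (p : nat) (t : C) (S : 'M[C]_p) k : (t *: S) ^+ k = t ^+ k *: S ^+ k.
Proof.
elim: k => [|k IH]; first by rewrite !expr0 scale1r.
have mE (A B : 'M[C]_p) : A * B = A *m B by [].
by rewrite !exprS IH !mE -scalemxAl -scalemxAr scalerA.
Qed.

Lemma exp_tail_has_sum (p L : nat) (S : 'M[C]_p) (rho : R) (c : C) (t : R) :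
  0 < rho -> 0 <= c -> (forall k i j, `|(S ^+ k) i j| <= c * rho%:C ^+ k) ->
  has_sum (fun k => if (L <= k)%N then t%:C ^+ k *: ((k`!%:R)^-1 *: S ^+ k) else 0)
    (exp_tail L (t%:C *: S)).
Proof.
move=> rho0 c0 HS; set u := (X in has_sum X _).
(* The geometric bound of ratio 1/2 comes from [(|t| rho)^k / k! = (x^k / k!) 2^-k <= e^x 2^-k]. *)
pose x := 2 * (`|t| * rho).
have x0 : 0 <= x by rewrite mulr_ge0// mulr_ge0// ltW.
have [|||s us] := @mx_geo_has_sum _ (@geo_complete_complex R) _ _ u
    (c * (expR x)%:C) (2^-1)%:C.
- by rewrite lecR invr_ge0.
- by rewrite ltcR; lra.
- move=> k i j; rewrite /u; case: ifP => _; last first.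
    rewrite mxE normr0; apply: mulr_ge0; last by apply: exprn_ge0; rewrite lecR invr_ge0.
    by apply: mulr_ge0 => //; rewrite lecR expR_ge0.
  rewrite !mxE !normrM normrX normfV normr_nat normc_real mulrA.
  have kr : (k`!%:R)^-1 = ((k`!%:R)^-1)%:C :> C by rewrite fmorphV rmorph_nat.
  rewrite kr -rmorphXn -rmorphM/=.
  apply: le_trans (ler_wpM2l _ (HS k i j)) _.
    by rewrite lecR mulr_ge0 ?exprn_ge0// invr_ge0.
  rewrite mulrCA -[leRHS]mulrA ler_wpM2l// -!rmorphXn -!rmorphM/= lecR.
  have -> : `|t| ^+ k / k`!%:R * rho ^+ k = x ^+ k / k`!%:R * 2^-1 ^+ k.
    rewrite mulrAC -exprMn [in RHS]mulrAC -exprMn /x.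
    by congr (_ ^+ k / _); rewrite mulrAC mulfV ?mul1r.
  by rewrite ler_wpM2r ?exprn_ge0 ?invr_ge0// expr_fact_le.
suff -> : exp_tail L (t%:C *: S) = s by [].
rewrite /exp_tail; apply: series_sumE; refine (eq_has_sum _ us) => k.
rewrite /u exprZ_mx; case: ifP => _; last by [].
by rewrite [LHS]scalerA [RHS]scalerA; congr (_ *: _); exact: mulrC.
Qed.

Lemma ReB (x y : C) : complex.Re (x - y) = complex.Re x - complex.Re y.
Proof. by case: x y => [? ?] []. Qed.

Lemma ImB (x y : C) : complex.Im (x - y) = complex.Im x - complex.Im y.
Proof. by case: x y => [? ?] []. Qed.

Lemma cvg_Re (T : Type) (F : set_system T) (FF : Filter F) (u : T -> C) (l : C) :
  u @ F --> (l : C^o) -> (fun x => complex.Re (u x)) @ F --> (complex.Re l : R^o).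
Proof.
move=> /(@cvgrPdist_lt _ C^o) ul; apply/(@cvgrPdist_lt _ R^o) => e e0.
have ec : (0 : C) < e%:C by rewrite ltcR.
apply: filterS (ul _ ec) => x H; rewrite -ltcR.
apply: le_lt_trans H; rewrite -normc_real -ReB.
exact: normc_ge_ReC.
Qed.

Lemma cvg_Im (T : Type) (F : set_system T) (FF : Filter F) (u : T -> C) (l : C) :
  u @ F --> (l : C^o) -> (fun x => complex.Im (u x)) @ F --> (complex.Im l : R^o).
Proof.
move=> /(@cvgrPdist_lt _ C^o) ul; apply/(@cvgrPdist_lt _ R^o) => e e0.
have ec : (0 : C) < e%:C by rewrite ltcR.
apply: filterS (ul _ ec) => x H; rewrite -ltcR.
apply: le_lt_trans H; rewrite -normc_real -ImB.
exact: normc_ge_ImC.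
Qed.

Lemma has_sum_Re (u : nat -> C) (s : C) :
  @has_sum C C^o u s -> @has_sum R R^o (fun k => complex.Re (u k)) (complex.Re s).
Proof.
move=> us; refine (@eq_cvg_to R R^o nat \oo _ _ _ _ (cvg_Re _ us)) => n.
elim: n => [|n IH]; first by rewrite !big_ord0.
by rewrite !big_ord_recr/= -IH; case: (\sum_(i < n) u i) (u n) => [? ?] [].
Qed.

Lemma has_sum_Im (u : nat -> C) (s : C) :
  @has_sum C C^o u s -> @has_sum R R^o (fun k => complex.Im (u k)) (complex.Im s).
Proof.
move=> us; refine (@eq_cvg_to R R^o nat \oo _ _ _ _ (cvg_Im _ us)) => n.
elim: n => [|n IH]; first by rewrite !big_ord0.
by rewrite !big_ord_recr/= -IH; case: (\sum_(i < n) u i) (u n) => [? ?] [].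
Qed.

End ExpTail.

(** * Integration of real power series *)

Section Integral.
Variable R : realType.
Let Rc := @geo_complete_real R.

Lemma psum_derivable (a : nat -> R) (d : R) (F : R -> R) (z : R) :
  psum a d F -> `|z| < d -> derivable (F : R -> R^o) z 1.
Proof.
move=> aF zd; have [l _ lc] := psum_derive_cvg Rc aF zd.
apply/cvg_ex; exists l; refine (eq_cvg_to _ lc) => h.
by rewrite /= [h%:A]mulr1.
Qed.

(** Termwise differentiation gives [F' = g], and the fundamental theorem of calculus applies since
    both functions are differentiable everywhere. *)
Lemma ointR_psum (a : nat -> R) (F g : R -> R) (t : R) :
  (forall d, psum a d F) -> (forall d, psum (fun j => a j.+1 *+ j.+1) d g) ->
  ointR 0 t g = F t - F 0.
Proof.
move=> aF ag.
have dF z : derivable (F : R -> R^o) z 1.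
  by apply: (psum_derivable (aF (`|z| + 1))); rewrite ltrDl.
have dg z : derivable (g : R -> R^o) z 1.
  by apply: (psum_derivable (ag (`|z| + 1))); rewrite ltrDl.
have cF z : {for z, continuous F}.
  by apply: differentiable_continuous; apply/derivable1_diffP; exact: dF.
have cg z : {for z, continuous g}.
  by apply: differentiable_continuous; apply/derivable1_diffP; exact: dg.
have F'g z : derive1 (F : R -> R^o) z = g z.
  have zd : `|z| < `|z| + 1 by rewrite ltrDl.
  exact: has_sum_unique (psum_derive1 Rc (aF _) zd) (ag _ z zd).
have ftc x y : x < y -> \int[lebesgue_measure]_(u in `[x, y]) g u = F y - F x.
  move=> xy; rewrite /Rintegral (@continuous_FTC2 R g F x y xy)//.
  - by apply: continuous_subspaceT => z; exact: cg.
  - split; first by move=> z _; exact: dF.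
      by apply: cvg_at_right_filter; exact: cF.
    by apply: cvg_at_left_filter; exact: cF.
rewrite /ointR; case: leP => [|t0]; last by rewrite ftc// opprB.
rewrite le_eqVlt => /predU1P[<-|t0]; last exact: ftc.
by rewrite set_itv1 Rintegral_set1 subrr.
Qed.

End Integral.

(** * The operator on exponential polynomials *)

Lemma natr_div_factS (K : numFieldType) (k : nat) :
  k.+1%:R / (k.+1)`!%:R = (k`!%:R)^-1 :> K.
Proof. by rewrite factS natrM invfM mulrA mulfV ?mul1r// pnatr_eq0. Qed.

Lemma scaler_invfactK (K : numFieldType) (V : lmodType K) (k : nat) (v : V) :
  (k`!%:R)^-1 *: (v *+ k`!) = v.
Proof.
by rewrite -[v *+ _]scaler_nat scalerA mulVf ?scale1r// pnatr_eq0 -lt0n fact_gt0.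
Qed.

Section MatrixPowerSeries.
Variable K : numFieldType.

Definition mpsum (m n : nat) (A : nat -> 'M[K]_(m, n)) (d : K) (g : K -> 'M[K]_(m, n)) :=
  forall z, `|z| < d -> has_sum (fun k => z ^+ k *: A k) (g z).

Lemma mpsumP (m n : nat) (A : nat -> 'M[K]_(m, n)) d g :
  mpsum A d g <-> forall i j, psum (fun k => A k i j) d (fun z => g z i j).
Proof.
split=> [H i j z zd|H z zd].
  have /has_sum_mxP/(_ i j) Hij := H z zd; refine (eq_has_sum _ Hij) => k.
  by rewrite mxE mulrC.
apply/has_sum_mxP => i j; refine (eq_has_sum _ (H i j z zd)) => k.
by rewrite mxE mulrC.
Qed.

Lemma mpsum_derive1n0 (Kc : geo_complete K) (m n : nat) (A : nat -> 'M[K]_(m, n)) d g k :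
  mpsum A d g -> 0 < d -> derive1n k g 0 = A k *+ k`!.
Proof. by move=> /mpsumP Ag d0; exact: mx_derive1n0 Kc _ _ _ _ Ag d0. Qed.

Lemma has_sum_scalel (m n : nat) (u : nat -> K) (s : K) (A : 'M[K]_(m, n)) :
  @has_sum K K^o u s -> has_sum (fun k => u k *: A) (s *: A).
Proof.
move=> us; apply/has_sum_mxP => i j; rewrite mxE mulrC.
refine (eq_has_sum _ (has_sumZ (a := A i j) us)) => k.
by rewrite mxE; exact: mulrC.
Qed.

End MatrixPowerSeries.
Arguments has_sum_scalel {K m n u s} A.

(** * Taylor coefficients of [M], of [B] and of functions of a real variable *)

Section Coefficients.
Variable R : realType.
Local Notation C := R[i].
Let Cc := @geo_complete_complex R.

Lemma Mfun_mpsum (n m : nat) (Ms : 'I_m -> 'M[C]_n) (f : 'I_m -> C -> C)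
    (a : 'I_m -> nat -> C) (d : C) : (forall i, psum (a i) d (f i)) ->
  mpsum (fun k => \sum_i a i k *: Ms i) d (Mfun Ms f).
Proof.
move=> af z zd.
refine (eq_has_sum _ (has_sum_big (fun i => has_sum_scalel (Ms i) (af i z zd)))) => k.
by rewrite scaler_sumr; apply: eq_bigr => i _; rewrite scalerA mulrC.
Qed.

(** Dividing [M(0) - M(z)] by [z] shifts the coefficients of [M] down by one; at [z = 0] only the
    term of index 0 survives, and it is the value chosen in [Bfun]. *)
Lemma Bfun_mpsum (n m : nat) (Ms : 'I_m -> 'M[C]_n) (f : 'I_m -> C -> C)
    (A : nat -> 'M[C]_n) (d : C) : 0 < d -> mpsum A d (Mfun Ms f) ->
  mpsum (fun k => - (invmx (Mfun Ms f 0) *m A k.+1)) d (Bfun Ms f).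
Proof.
move=> d0 AM z zd; rewrite /Bfun; case: eqP => [->|/eqP z0].
  have -> : cderivn 1 (Mfun Ms f : C^o -> 'M[C]_n) 0 = A 1%N.
    by rewrite /cderivn (mpsum_derive1n0 Cc _ AM d0).
  have H := has_sum_fin (n := 1)
    (u := fun k => 0 ^+ k *: (- (invmx (Mfun Ms f 0) *m A k.+1)) : 'M[C]_n).
  move: H; rewrite big_ord1 expr0 scale1r; apply.
  by case=> // k _; rewrite expr0n scale0r.
have M0 : Mfun Ms f 0 = A 0%N.
  have := mpsum_derive1n0 Cc 0 AM d0; exact.
have H := (has_sum_drop 1 _ _).1 (AM z zd).
rewrite big_ord1 expr0 scale1r -M0 in H.
have -> : z^-1 *: (invmx (Mfun Ms f 0) *m (Mfun Ms f 0 - Mfun Ms f z)) =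
    - z^-1 *: (invmx (Mfun Ms f 0) *m (Mfun Ms f z - Mfun Ms f 0)).
  by rewrite -[in RHS]opprB mulmxN scalerN scaleNr opprK.
refine (eq_has_sum _ (has_sumZ (a := - z^-1) (has_sum_mulmxl _ H))) => k.
rewrite -scalemxAr scalerA exprD expr1 scalerN.
by rewrite mulNr mulrA mulVf// mul1r scaleNr add1n.
Qed.

Lemma Re_realM (t : R) (z : C) : complex.Re (t%:C * z) = t * complex.Re z.
Proof. by case: z => a b /=; rewrite mul0r subr0. Qed.

Lemma Im_realM (t : R) (z : C) : complex.Im (t%:C * z) = t * complex.Im z.
Proof. by case: z => a b /=; rewrite mul0r addr0. Qed.

Lemma Re_natmul (z : C) k : complex.Re (z *+ k) = complex.Re z *+ k.
Proof.
elim: k => [|k IH]; first by rewrite !mulr0n.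
by rewrite !mulrSr -IH; case: {IH}(z *+ k) => ? ?; case: z.
Qed.

Lemma Im_natmul (z : C) k : complex.Im (z *+ k) = complex.Im z *+ k.
Proof.
elim: k => [|k IH]; first by rewrite !mulr0n.
by rewrite !mulrSr -IH; case: {IH}(z *+ k) => ? ?; case: z.
Qed.

Section RealVariable.
Variables (n : nat) (P : nat -> 'cV[C]_n) (g : R -> 'cV[C]_n).
Hypothesis Pg : forall t : R, has_sum (fun k => t%:C ^+ k *: P k) (g t).

Lemma psum_Re d j : psum (fun k => complex.Re (P k j 0)) d (fun t => complex.Re (g t j 0)).
Proof.
move=> t _; have /has_sum_mxP/(_ j 0)/has_sum_Re H := @Pg t.
refine (eq_has_sum _ H) => k.
by rewrite mxE -rmorphXn Re_realM mulrC.
Qed.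

Lemma psum_Im d j : psum (fun k => complex.Im (P k j 0)) d (fun t => complex.Im (g t j 0)).
Proof.
move=> t _; have /has_sum_mxP/(_ j 0)/has_sum_Im H := @Pg t.
refine (eq_has_sum _ H) => k.
by rewrite mxE -rmorphXn Im_realM mulrC.
Qed.

Lemma rderivn_coef k : rderivn k g 0 = P k *+ k`!.
Proof.
rewrite /rderivn.
rewrite (@mx_derive1n0 R n 1 (@geo_complete_real R) (fun k => map_mx (@complex.Re R) (P k)) 1)//.
  rewrite (@mx_derive1n0 R n 1 (@geo_complete_real R) (fun k => map_mx (@complex.Im R) (P k)) 1)//.
    apply/matrixP => i j; rewrite !mxE !mulmxnE !mxE !rmorphMn/= mulrnAr -mulrnDl.
    by rewrite -complexE.
  move=> i j; rewrite (ord1 j) => t td.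
  by have := @psum_Im 1 i t td; rewrite mxE; apply: eq_has_sum => l; rewrite mxE.
move=> i j; rewrite (ord1 j) => t td.
by have := @psum_Re 1 i t td; rewrite mxE; apply: eq_has_sum => l; rewrite mxE.
Qed.

End RealVariable.
Arguments psum_Re {n P g} Pg d j.
Arguments psum_Im {n P g} Pg d j.

(** The relation between [Q] and [P] says coefficientwise that [G' = g]; [ointR_psum] is applied to
    the real and imaginary parts of each entry. *)
Lemma vint_coef (n : nat) (P Q : nat -> 'cV[C]_n) (g G : R -> 'cV[C]_n) (t : R) :
  (forall t : R, has_sum (fun k => t%:C ^+ k *: P k) (g t)) ->
  (forall t : R, has_sum (fun k => t%:C ^+ k *: Q k) (G t)) ->
  (forall k, Q k.+1 *+ k.+1 = P k) -> vint g t = G t - G 0.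
Proof.
move=> Pg QG QP; apply/matrixP => j l; rewrite (ord1 l) !mxE.
rewrite (@ointR_psum R (fun k => complex.Re (Q k j 0)) (fun t => complex.Re (G t j 0))).
- rewrite (@ointR_psum R (fun k => complex.Im (Q k j 0)) (fun t => complex.Im (G t j 0))).
  + by rewrite -ReB -ImB -complexE.
  + by move=> d; exact: psum_Im.
  + move=> d; refine (eq_psum _ (psum_Im Pg d j)) => k.
    by rewrite -QP mulmxnE Im_natmul.
- by move=> d; exact: psum_Re.
- move=> d; refine (eq_psum _ (psum_Re Pg d j)) => k.
  by rewrite -QP mulmxnE Re_natmul.
Qed.

Arguments vint_coef {n P Q g G} t Pg QG QP : rename.

(** Taylor coefficients of an exponential polynomial: the two cases do not overlap, because the
    exponential tail starts at degree [N]. *)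
Definition exp_poly_coef (n p N : nat) (Y : 'M[C]_(n, p)) (S : 'M[C]_p) (c : 'cV[C]_p)
    (x : nat -> 'cV[C]_n) (k : nat) : 'cV[C]_n :=
  if (k < N)%N then x k else (k`!%:R)^-1 *: (Y *m S ^+ k *m c).

Lemma exp_poly_has_sum (n p N : nat) (Y : 'M[C]_(n, p)) (S : 'M[C]_p) (c : 'cV[C]_p)
    (x : nat -> 'cV[C]_n) (rho : R) (b : C) (t : R) :
  0 < rho -> 0 <= b -> (forall k i j, `|(S ^+ k) i j| <= b * rho%:C ^+ k) ->
  has_sum (fun k => t%:C ^+ k *: exp_poly_coef N Y S c x k)
    (Y *m exp_tail N (t%:C *: S) *m c + \sum_(j < N) (t ^+ j)%:C *: x j).
Proof.
move=> rho0 b0 HS.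
have H1 := has_sum_mulmxr c (has_sum_mulmxl Y (@exp_tail_has_sum R p N S rho b t rho0 b0 HS)).
have H2 := has_sum_fin (n := N) (u := fun k => if (k < N)%N then t%:C ^+ k *: x k else 0).
have {}H2 : has_sum (fun k => if (k < N)%N then t%:C ^+ k *: x k else 0)
    (\sum_(j < N) (t ^+ j)%:C *: x j).
  have -> : \sum_(j < N) (t ^+ j)%:C *: x j =
      \sum_(j < N) (if (j < N)%N then t%:C ^+ j *: x j else 0).
    by apply: eq_bigr => j _; rewrite ltn_ord rmorphXn.
  by apply: H2 => k; rewrite leqNgt => /negPf ->.
refine (eq_has_sum _ (has_sumD H1 H2)) => k.
rewrite /exp_poly_coef leqNgt; case: ltnP => _ /=.
  by rewrite mulmx0 mul0mx add0r.
by rewrite addr0 -!scalemxAr -!scalemxAl.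
Qed.

End Coefficients.

Theorem mainTheorem2 (R : realType) (r : R) (n m p N : nat)
  (Ms : 'I_m -> 'M[R[i]]_n) (f : 'I_m -> R[i] -> R[i])
  (Y : 'M[R[i]]_(n, p)) (S : 'M[R[i]]_p) (c : 'cV[R[i]]_p)
  (x : nat -> 'cV[R[i]]_n) (phi : R -> 'cV[R[i]]_n) :
  0 < r ->
  (forall i, analytic_on_disc r (f i)) ->
  Mfun Ms f 0 \in unitmx ->
  S \in unitmx ->
  (forall a, eigenvalue S a -> in_disc r a) ->
  (forall theta : R,
     phi theta = Y *m exp_tail N (theta%:C *: S) *m c +
                 \sum_(j < N) (theta ^+ j)%:C *: x j) ->
  let cplus := invmx S *m c in
  let xplus := fun j : nat =>
    if j == 0%N then
      - (invmx (Mfun Ms f 0) *m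
          (bbM_N Ms f N Y S *m cplus +
           \sum_(1 <= i < N.+1)
              cderivn i (Mfun Ms f : R[i]^o -> 'M[R[i]]_n) 0 *m
                ((i%:R)^-1 *: x i.-1)))
    else (j%:R)^-1 *: x j.-1 in
  exists s : 'cV[R[i]]_n,
    has_sum (B_series_term Ms f phi) s /\
    forall theta : R,
      vint phi theta + s =
      Y *m exp_tail N.+1 (theta%:C *: S) *m cplus +
      \sum_(j < N.+1) (theta ^+ j)%:C *: xplus j.
Proof.
move=> r0 fa _ Su Sr phiE cplus xplus.
have Cc := @geo_complete_complex R.
have r0c : (0 : R[i]) < r%:C by rewrite ltcR.
have [a af] := choice (fun i => analytic_disc_psum r0 (fa i)).
have [rho [b [rho0 rhor b0 HS]]] := mx_power_bound r0 Sr.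
set M := Mfun Ms f.
pose A k := \sum_i a i k *: Ms i.
have AM : mpsum A r%:C M by exact: Mfun_mpsum.
have MD k : cderivn k (M : R[i]^o -> 'M[R[i]]_n) 0 = A k *+ k`!.
  exact: (mpsum_derive1n0 Cc k AM r0c).
have kn0 k : (k`!%:R : R[i]) != 0 by rewrite pnatr_eq0 -lt0n fact_gt0.
have phiP t : has_sum (fun k => t%:C ^+ k *: exp_poly_coef N Y S c x k) (phi t).
  by rewrite phiE; exact: exp_poly_has_sum rho0 b0 HS.
pose Psi t := Y *m exp_tail N.+1 (t%:C *: S) *m cplus +
      \sum_(j < N.+1) (t ^+ j)%:C *: xplus j.
have PsiP t : has_sum (fun k => t%:C ^+ k *: exp_poly_coef N.+1 Y S cplus xplus k) (Psi t).
  exact: exp_poly_has_sum rho0 b0 HS.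
(* This is [Psi' = phi]: below degree [N] by the choice of [xplus], from [N] on because
   [S^(k + 1) S^-1 c = S^k c]. *)
have PP k : exp_poly_coef N.+1 Y S cplus xplus k.+1 *+ k.+1 = exp_poly_coef N Y S c x k.
  rewrite /exp_poly_coef ltnS; case: ifP => _.
    by rewrite /xplus /= -scaler_nat scalerA mulfV ?scale1r// pnatr_eq0.
  rewrite -scaler_nat scalerA natr_div_factS.
  congr (_ *: _); rewrite exprSr /cplus !mulmxA; congr (_ *m _).
  by rewrite mulmxK.
have V t := vint_coef t phiP PsiP PP.
(* The exponential tail starts at degree [N + 1 >= 1], so it does not contribute to the constant
   term. *)
have Psi0 : Psi 0 = xplus 0%N.
  have H := has_sum_fin (n := 1)
    (u := fun k => (0 : R)%:C ^+ k *: exp_poly_coef N.+1 Y S cplus xplus k).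
  rewrite (has_sum_unique (PsiP 0) (H _)).
    by rewrite big_ord1 expr0 scale1r.
  by case=> // k _; rewrite rmorph0 expr0n scale0r.
exists (xplus 0%N); split; last by move=> t; rewrite V Psi0 subrK.
have BT k : B_series_term Ms f phi k =
    - (invmx (M 0) *m (A k.+1 *m (exp_poly_coef N Y S c x k *+ k`!))).
  rewrite /B_series_term (rderivn_coef phiP).
  rewrite /cderivn (mpsum_derive1n0 Cc k (Bfun_mpsum r0c AM) r0c).
  by rewrite scalemxAl scaler_invfactK mulNmx mulmxA.
have aD i k : cderivn k (f i : R[i]^o -> R[i]^o) 0 = a i k *+ k`!.
  exact: (psum_derive1n0 Cc k (af i) r0c).
have rr : rho%:C < r%:C :> R[i] by rewrite ltcR.
have matS i : has_sum (fun k => a i k *: S ^+ k) (matfun (f i) S).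
  (* For [t] strictly between, the coefficients of [f i] are [O(t^-k)] and the powers of [S] are
     [O(rho^k)]. *)
  have [t rt tr] := lt_between rr.
  have rhoc : (0 : R[i]) < rho%:C by rewrite ltcR.
  have t0 : 0 < t by apply: lt_trans rt.
  have [d d0 Hd] := psum_bounded (af i) (ltW t0) tr.
  have [||k u v|s us] := @mx_geo_has_sum _ Cc _ _ (fun k => a i k *: S ^+ k) (d * b) (rho%:C / t).
  - by rewrite divr_ge0// ltW.
  - by rewrite ltr_pdivrMr// mul1r.
  - rewrite mxE normrM expr_div_n.
    apply: le_trans (ler_wpM2l (normr_ge0 _) (HS k u v)) _.
    rewrite -mulrA mulrCA [leRHS]mulrCA ler_wpM2l// mulrA ler_pdivlMr ?exprn_gt0//.
    by rewrite mulrAC ler_wpM2r ?Hd// exprn_ge0// ltW.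
  suff -> : matfun (f i) S = s by [].
  apply: series_sumE; refine (eq_has_sum _ us) => k.
  by rewrite aD -[a i k *+ _]mulr_natl mulrA mulVf// mul1r.
have bbS : has_sum (fun k => A k *m Y *m S ^+ k) (bbM Ms f Y S).
  refine (eq_has_sum _ (has_sum_big (fun i => has_sum_mulmxl (Ms i *m Y) (matS i)))) => k.
  rewrite /A !mulmx_suml; apply: eq_bigr => i _.
  by rewrite -scalemxAr -!scalemxAl.
(* [bbM_N] subtracts exactly the first [N + 1] terms of the series for [bbM]. *)
have bbNS : has_sum (fun j => A (N.+1 + j)%N *m Y *m S ^+ (N.+1 + j)) (bbM_N Ms f N Y S).
  have := (has_sum_drop N.+1 _ _).1 bbS; congr (has_sum _ (_ - _)).
  by apply: eq_bigr => k _; rewrite MD !scalemxAl scaler_invfactK.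
(* The first [N] terms match the finite sum in [xplus 0], by [(k + 1)! / (k + 1) = k!]; the tail
   remains. *)
apply/(has_sum_drop N).
have -> : xplus 0%N - \sum_(k < N) B_series_term Ms f phi k =
    - (invmx (M 0) *m (bbM_N Ms f N Y S *m cplus)).
  rewrite /xplus eqxx mulmxDr opprD -[RHS]addr0 -addrA; congr (_ + _).
  apply/eqP; rewrite subr_eq0 big_add1 big_mkord mulmx_sumr -sumrN.
  apply/eqP; apply: eq_bigr => k _; rewrite BT; congr (- (_ *m _)).
  rewrite MD /exp_poly_coef ltn_ord /= -scalemxAr -[A _ *+ _]scaler_nat -scalemxAl scalerA.
  rewrite -[x k *+ _]scaler_nat -scalemxAr; congr (_ *: _).
  by rewrite factS natrM mulrA mulVf ?mul1r// pnatr_eq0.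
(* Term [N + k] involves [A (N + 1 + k)], and [S^(N + k) c = S^(N + 1 + k) cplus]. *)
refine (eq_has_sum _ (has_sumN (has_sum_mulmxl (invmx (M 0)) (has_sum_mulmxr cplus bbNS)))) => k.
rewrite BT; congr (- (_ *m _)).
rewrite /exp_poly_coef ltnNge leq_addr /= -scaler_nat scalerA mulfV// scale1r.
rewrite addSn exprSr /cplus -!mulmxA; congr (_ *m (_ *m _)).
by rewrite mulKVmx.
Qed.
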